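(* Let $f(x,y,z)=x^2+y^3+yz^3$ and let $X=V(f)\subset\mathbb{C}^3$ (the $E_7$-singularity), with Gröbner fan $G(X)$. The embedded toric resolution of $X$ constructed by a regular refinement of $G(X)$ with the elements of the sets $\mathbb{Z}^3\cap p_C$, where $C$ is a maximal dimensional Gröbner cone in $G(X)$ and $p_C$ is its profile, is minimal.
   Context: For $v\in(\mathbb{R}_{\ge0})^3$ and $f=\sum_\alpha c_\alpha x^{\alpha_1}y^{\alpha_2}z^{\alpha_3}$, let $o_v(f)=\min\{v\cdot\alpha: c_\alpha\neq0\}$, and let $In_v(f)$ be the sum of the terms of $f$ with $c_\alpha\ne0$ and $v\cdot\alpha=o_v(f)$. The closure of $\{w\in(\mathbb{R}_{\ge0})^3: In_w(f)=In_v(f)\}$ is a polyhedral cone, called a Gröbner cone; these cones form a fan in the first orthant, the Gröbner fan $G(X)$. Here the maximal dimensional Gröbner cones are $\langle(1,0,0),(0,0,1),(9,6,4)\rangle$, $\langle(0,1,0),(0,0,1),(1,2,0),(9,6,4)\rangle$ and $\langle(1,0,0),(1,2,0),(9,6,4)\rangle$, where $\langle\cdot\rangle$ denotes the cone of nonnegative real combinations. The skeleton of $G(X)$ is the union of its cones that are not maximal dimensional. The primitive vector on a 1-dimensional face of a cone is called an extremal vector. The profile $p_C$ of a cone $C=\langle v_1,\dots,v_r\rangle$ is the convex hull (a bounded region) such that its extremal vectors are exactly $v_1,\dots,v_r$; the hyperplanes containing the extremal vectors are called its boundary. Here the boundaries of the three profiles are $x-2y+z-1=0$, $x-y-z+1=0$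 and $x-2z-1=0$, respectively. A cone is regular if the gcd of the maximal minors of the matrix whose columns are its primitive generators is $\pm1$; a fan is regular if all its cones are. A regular refinement is a subdivision into regular cones obtained by adding vectors. A regular refinement $\Sigma$ of $G(X)$ yields an embedded toric resolution of $X$: the associated toric morphism $\pi_\Sigma:X_\Sigma\to\mathbb{C}^3$ is proper and birational, and the irreducible components of the total transform of $X$ are smooth and meet transversally. An embedded toric resolution is called minimal if (1) the vectors in the regular refinement are irreducible (free over $\mathbb{Z}$: an element in the refinement is irreducible if it cannot be written as a sum of two other elements), and (2) the resolution graph obtained from the refinement (given by the elements on the skeleton of $G(X)$) has no $-1$ curve, i.e. the self-intersection of each vertex is different from $-1$. The self-intersection of a vertex $v$ is the number $-s\in\mathbb{Z}_{\le0}$ with $s\,v=\sum_i v_i$, where the $v_i$ are the vectors adjacent to $v$ in the regular refinement.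
   Formalization: ''Irreducible'' is taken within each Gröbner cone: a vector is not a sum of two other lattice points of a Gröbner cone containing it. Over the whole refinement it fails: (1,1,0)=(1,0,0)+(0,1,0), all vectors of the refinement. *)

(* Defs.v *)
From HB Require Import structures.
From mathcomp Require Import all_boot all_order all_algebra.
(* mpoly has to be imported before the analysis files: the levels of their
   notations clash in the other order. *)
From mathcomp Require Import complex mpoly.
From mathcomp Require Import boolp classical_sets functions cardinality fsbigop.
From mathcomp Require Import reals topology normedtype convex.
Set Implicit Arguments.
Unset Strict Implicit.
Unset Printing Implicit Defensive.
Import Order.TTheory GRing.Theory Num.Theory numFieldTopology.Exports.
Local Open Scope classical_set_scope.
Local Open Scope ring_scope.

Definition lattice := 'rV[int]_3.

Definition realv (R : realType) (v : lattice) : 'rV[R]_3 := map_mx intr v.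

Definition orthant (R : realType) : set 'rV[R]_3 :=
  [set v | forall i, 0 <= v 0 i].
Arguments orthant : clear implicits.

(** ** Cones, faces, fans *)

Definition cone_of (R : realType) k (s : k.-tuple lattice) : set 'rV[R]_3 :=
  [set x | exists2 c : 'I_k -> R, (forall i, 0 <= c i) &
                                  x = \sum_i c i *: realv R (tnth s i)].
Arguments cone_of R {k} s.

Definition ray (R : realType) (v : lattice) : set 'rV[R]_3 :=
  [set x | exists2 t : R, 0 <= t & x = t *: realv R v].
Arguments ray : clear implicits.

Definition face (R : realType) (C F : set 'rV[R]_3) : Prop :=
  exists2 l : 'cV[R]_3, (forall x, C x -> 0 <= (x *m l) 0 0) &
                        F = C `&` [set x | (x *m l) 0 0 = 0].

Definition primitive (v : lattice) : Prop := \big[gcdz/0]_i v 0 i = 1.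

Definition extremal (R : realType) (C : set 'rV[R]_3) : set lattice :=
  [set v | primitive v /\ face C (ray R v)].

(* C spans the ambient space R^3. *)
Definition full_dim (R : realType) (C : set 'rV[R]_3) : Prop :=
  exists2 M : 'M[R]_3, (forall i, C (row i M)) & row_free M.

Definition profile (R : realType) (C : set 'rV[R]_3) : set 'rV[R]_3 :=
  smallest (@convex_set R 'rV[R]_3) (realv R @` extremal C).

(* The maximal minors of the 3 x k matrix whose columns are the k generators
   are the k x k ones. For k > 3 they all vanish (a row is repeated), so a
   regular cone is simplicial. The minors are indexed by all maps
   'I_k -> 'I_3 instead of the increasing ones: this only adds zeroes and
   changes of sign, which the gcd ignores. *)
Definition regular_cone (R : realType) (C : set 'rV[R]_3) : Prop :=
  exists k (s : k.-tuple lattice),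
    [/\ uniq s,
        (forall v, v \in s <-> extremal C v)
      & let M := \matrix_(i < 3, j < k) tnth s j 0 i in
        \big[gcdz/0]_(g : {ffun 'I_k -> 'I_3}) \det (rowsub g M) = 1].

Definition fan (R : realType) (Sigma : set (set 'rV[R]_3)) : Prop :=
  [/\ finite_set Sigma,
      (forall C, Sigma C -> exists k (s : k.-tuple lattice), C = cone_of R s),
      (forall C, Sigma C -> forall x, C x -> C (- x) -> x = 0),
      (forall C F, Sigma C -> face C F -> Sigma F)
    & (forall C D, Sigma C -> Sigma D -> face C (C `&` D))].

(* The vectors of a fan: the primitive generators of its 1-dimensional cones. *)
Definition rays (R : realType) (Sigma : set (set 'rV[R]_3)) : set lattice :=
  [set v | primitive v /\ Sigma (ray R v)].

Definition regular_refinement (R : realType)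
    (Sigma G : set (set 'rV[R]_3)) : Prop :=
  [/\ fan Sigma,
      (forall C, Sigma C -> regular_cone C),
      (forall C, Sigma C -> exists2 D, G D & C `<=` D)
    & \bigcup_(C in Sigma) C = \bigcup_(D in G) D].

(** ** Initial forms and the Groebner fan *)

Definition weight (R : realType) (v : 'rV[R]_3) (m : 'X_{1..3}) : R :=
  \sum_i v 0 i * (m i)%:R.

(* The minimum of v.m over the support of f (for f != 0). *)
Definition order_at (R : realType) (v : 'rV[R]_3) (f : {mpoly R[i][3]}) : R :=
  \big[Num.min/weight v (head 0%MM (msupp f))]_(m <- msupp f) weight v m.

Definition initial_form (R : realType) (v : 'rV[R]_3) (f : {mpoly R[i][3]}) :
    {mpoly R[i][3]} :=
  \sum_(m <- msupp f | weight v m == order_at v f) f@_m *: 'X_[m].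

Definition groebner_cone (R : realType) (f : {mpoly R[i][3]})
    (v : 'rV[R]_3) : set 'rV[R]_3 :=
  closure [set w : 'rV[R]_3 |
            orthant R w /\ initial_form w f = initial_form v f].

Definition groebner_fan (R : realType) (f : {mpoly R[i][3]}) :
    set (set 'rV[R]_3) :=
  [set groebner_cone f v | v in orthant R].

Definition skeleton (R : realType) (f : {mpoly R[i][3]}) : set 'rV[R]_3 :=
  \bigcup_(C in [set C | groebner_fan f C /\ ~ full_dim C]) C.

Definition profile_points (R : realType) (f : {mpoly R[i][3]}) : set lattice :=
  [set v | exists C, [/\ groebner_fan f C, full_dim C & profile C (realv R v)]].

(** ** Embedded toric resolutions *)

(* The generators of a 3-dimensional cone of Sigma, in some order; each such
   cone gives an affine chart C^3 of the toric variety of Sigma. *)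
Definition chart (R : realType) (Sigma : set (set 'rV[R]_3))
    (v : 3.-tuple lattice) : Prop :=
  [/\ uniq v, (forall w, w \in v -> rays Sigma w) & Sigma (cone_of R v)].

(* The j-th component of the toric morphism in the chart given by v_0, v_1, v_2:
   u_0^(v_0)_j * u_1^(v_1)_j * u_2^(v_2)_j. The absolute value only turns the
   entries, which are nonnegative in the first orthant, into naturals. *)
Definition chart_monomial (R : realType) (v : 3.-tuple lattice) (j : 'I_3) :
    {mpoly R[i][3]} :=
  'X_[[multinom `|tnth v i ord0 j|%N | i < 3]].

Definition chart_map (R : realType) (v : 3.-tuple lattice)
    (u : 'I_3 -> R[i]) : 'I_3 -> R[i] :=
  fun j => (chart_monomial R v j).@[u].

Definition total_transform (R : realType) (f : {mpoly R[i][3]})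
    (v : 3.-tuple lattice) : {mpoly R[i][3]} :=
  f \mPo [tuple chart_monomial R v j | j < 3].

Definition torus (R : realType) : set ('I_3 -> R[i]) :=
  [set u | forall i, u i != 0].
Arguments torus : clear implicits.

(* In a chart, the total transform of V(f) is u^m * g = 0 with g prime to the
   coordinates: g = 0 is the strict transform, and the divisor u_i = 0 is one
   of the other components if and only if m i != 0. *)
Definition strict_transform (R : realType) (f : {mpoly R[i][3]})
    (v : 3.-tuple lattice) (m : 'X_{1..3}) (g : {mpoly R[i][3]}) : Prop :=
  total_transform f v = 'X_[m] * g /\
  forall i (h : {mpoly R[i][3]}), g <> 'X_i * h.

(* At each point p of the strict transform, the differential of g and those of
   the coordinates u_i defining the other components through p are linearly
   independent; c and d are the coefficients of a linear relation. (Away from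
   g = 0 the components are coordinate planes.) *)
Definition snc_total_transform (R : realType) (f : {mpoly R[i][3]})
    (v : 3.-tuple lattice) : Prop :=
  forall m g, strict_transform f v m g ->
  forall p : 'I_3 -> R[i], g.@[p] = 0 ->
  forall (c : R[i]) (d : 'I_3 -> R[i]),
    (forall i, ~~ ((m i != 0%N) && (p i == 0)) -> d i = 0) ->
    (forall j, c * (g^`M(j)).@[p] + d j = 0) ->
    c = 0 /\ forall i, d i = 0.

(* Sigma subdivides the first orthant, the fan of C^3, which for a toric
   morphism to C^3 means that it is proper. *)
Definition embedded_toric_resolution (R : realType) (f : {mpoly R[i][3]})
    (Sigma : set (set 'rV[R]_3)) : Prop :=
  [/\ fan Sigma,
      (forall C, Sigma C -> regular_cone C),
      \bigcup_(C in Sigma) C = orthant R,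
      (forall v, chart Sigma v -> set_bij (torus R) (torus R) (chart_map v))
    & (forall v, chart Sigma v -> snc_total_transform f v)].

(** ** Minimality *)

(* Irreducibility refers to a cone: in the whole first orthant only the
   standard basis vectors would be irreducible. *)
Definition irreducible_in (R : realType) (C : set 'rV[R]_3) (v : lattice) :
    Prop :=
  ~ exists u w : lattice,
      [/\ C (realv R u), C (realv R w), u != v, w != v & v = u + w].

Definition vertices (R : realType) (f : {mpoly R[i][3]})
    (Sigma : set (set 'rV[R]_3)) : set lattice :=
  [set v | rays Sigma v /\ skeleton f (realv R v)].

(* The vertices joined to v in the resolution graph: its edges are the
   2-dimensional cones of Sigma lying on the skeleton. *)
Definition adjacent (R : realType) (f : {mpoly R[i][3]})
    (Sigma : set (set 'rV[R]_3)) (v : lattice) : set lattice :=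
  [set w | [/\ w != v, vertices f Sigma w, Sigma (cone_of R [tuple v; w])
             & cone_of R [tuple v; w] `<=` skeleton f]].

(* n is the self-intersection number of v. It is a relation because there is
   no such n for the vertices whose curves are not compact. *)
Definition self_intersection (R : realType) (f : {mpoly R[i][3]})
    (Sigma : set (set 'rV[R]_3)) (v : lattice) (n : int) : Prop :=
  n <= 0 /\ v *~ (- n) = \sum_(w \in adjacent f Sigma v) w.

Definition minimal_embedded_toric_resolution (R : realType)
    (f : {mpoly R[i][3]}) (Sigma : set (set 'rV[R]_3)) : Prop :=
  [/\ embedded_toric_resolution f Sigma,
      (forall v C, rays Sigma v -> groebner_fan f C -> C (realv R v) ->
         irreducible_in C v)
    & (forall v n, vertices f Sigma v -> self_intersection f Sigma v n ->
         n <> -1)].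

Definition E7 (R : realType) : {mpoly R[i][3]} :=
  'X_0 ^+ 2 + 'X_1 ^+ 3 + 'X_1 * 'X_2 ^+ 3.

(* Main.v *)
Require Import Defs.
From HB Require Import structures.
From mathcomp Require Import all_boot all_order all_algebra perm.
From mathcomp Require Import complex mpoly.
From mathcomp Require Import boolp classical_sets functions cardinality fsbigop.
From mathcomp Require Import reals interval_inference topology normedtype.
From mathcomp Require Import convex.
From mathcomp Require Import zify ring lra.
Set Implicit Arguments.
Unset Strict Implicit.
Unset Printing Implicit Defensive.
Import Order.TTheory GRing.Theory Num.Theory numFieldTopology.Exports.
Local Open Scope classical_set_scope.
Local Open Scope ring_scope.

(** The Groebner fan. The monomials x^2, y^3 and y z^3 of f have weights 2a,
    3b and b + 3c at (a, b, c). A Groebner cone is the set of the vectors of the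
    first orthant where the monomials of a given set are minimal
    (groebner_coneE, E7_coneE), so there are three maximal cones, mcone k,
    where the monomial of index k is minimal, and the skeleton is the set of
    the vectors where the minimum is attained twice. The vectors of the profile
    of mcone k are those of the cone where a linear form, level k, with integer
    coefficients takes the value 1 (profile_mcone).

    Existence of the refinement. The lattice points of the three profiles are
    the vertices of a triangulation by triangles of determinant 1 or -1. This
    triangulation is regular: there is a convex function on the orthant that is
    linear on the cone over each triangle and on no larger cone, and it is
    recorded by attaching a linear form to each triangle. Its convexity does the
    work of comparing all pairs of cones. Two cones meet along the cone of their
    common generators, because the difference of the two forms separates them
    (table_meet); and the cones cover the orthant, because x lies in the cone
    whose form is the largest at x (table_cover). What remains is a finite
    computation on the list of triangles.

    Minimality, for any refinement with these vectors. A chart has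
    determinant 1 or -1, since its three vectors are the extremal vectors of a
    regular cone (chart_unitmx); so the monomial map is a bijection of the
    torus. The cone of a chart lies in some mcone k, where the monomial of
    index k can be factored out of the total transform. The remaining factor
    is a sum of three monomials, one of which is 1, and it is transversal to the
    coordinate planes because the three exponents of f are linearly independent
    (snc_chart). A vector of a profile is irreducible in a cone because its
    level is 1 and the level is a positive integer at the nonzero lattice points
    of the cone (irreducible_profile). Finally a vector of self-intersection -1
    would be the sum of the vectors adjacent to it; these are among its
    neighbours on the segments of the skeleton, which is the cone over a
    tripod, and no vector is the sum of some of its neighbours
    (no_minus_one_curve). *)

(** * Cones spanned by lattice vectors *)

Section Cones.
Variable R : realType.
Implicit Types (x : 'rV[R]_3) (v w : lattice) (s t : seq lattice).

Definition gcone s : set 'rV[R]_3 :=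
  [set x | exists2 c : lattice -> R, (forall v, 0 <= c v) &
                                     x = \sum_(v <- s) c v *: realv R v].

Lemma realvE v i : realv R v 0 i = (v 0 i)%:~R.
Proof. by rewrite mxE. Qed.

Lemma realvD v w : realv R (v + w) = realv R v + realv R w.
Proof. by apply/rowP => i; rewrite !mxE intrD. Qed.

Lemma realv_inj : injective (realv R).
Proof.
move=> v w /rowP E; apply/rowP => i; have := E i.
by rewrite !realvE => /intr_inj.
Qed.

Lemma gcone_orthant s : {in s, forall v i, 0 <= v 0 i} ->
  gcone s `<=` orthant R.
Proof.
move=> s0 _ [c c0 ->] i; rewrite summxE big_seq sumr_ge0// => v vs.
by rewrite mxE realvE mulr_ge0// ler0z s0.
Qed.

Lemma gcone0 s : gcone s 0.
Proof.
by exists (fun=> 0) => //; rewrite big1// => v _; rewrite scale0r.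
Qed.

Lemma gconeD s x y : gcone s x -> gcone s y -> gcone s (x + y).
Proof.
move=> [c c0 ->] [d d0 ->]; exists (fun v => c v + d v).
  by move=> v; rewrite addr_ge0.
by rewrite -big_split; apply: eq_bigr => v _; rewrite scalerDl.
Qed.

Lemma gconeZ s a x : 0 <= a -> gcone s x -> gcone s (a *: x).
Proof.
move=> a0 [c c0 ->]; exists (fun v => a * c v).
  by move=> v; rewrite mulr_ge0.
by rewrite scaler_sumr; apply: eq_bigr => v _; rewrite scalerA.
Qed.

Lemma gcone_sum (I : eqType) s (r : seq I) (F : I -> 'rV[R]_3) :
  {in r, forall i, gcone s (F i)} -> gcone s (\sum_(i <- r) F i).
Proof.
move=> sF; rewrite big_seq; apply: (big_ind (gcone s)) => //.
- exact: gcone0.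
- exact: gconeD.
Qed.

Lemma gcone_gen s v : uniq s -> v \in s -> gcone s (realv R v).
Proof.
move=> us vs; exists (fun u => (u == v)%:R) => [u|]; first exact: ler0n.
rewrite (bigD1_seq v)//= eqxx scale1r big1 ?addr0// => u /negPf ->.
by rewrite scale0r.
Qed.

Lemma gcone_sub s t : uniq t -> {subset s <= t} -> gcone s `<=` gcone t.
Proof.
move=> ut st _ [c c0 ->]; apply: gcone_sum => v vs.
by apply: gconeZ => //; apply: gcone_gen => //; exact: st.
Qed.

Lemma ray_gcone v : ray R v = gcone [:: v].
Proof.
apply/seteqP; split => x [].
  by move=> a a0 ->; exists (fun=> a) => //; rewrite big_seq1.
by move=> c c0 ->; exists (c v) => //; rewrite big_seq1.
Qed.

Lemma cone_of_gcone k (s : k.-tuple lattice) : uniq s -> cone_of R s = gcone s.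
Proof.
move=> us; apply/seteqP; split => x.
  move=> [c c0 ->].
  have : {in index_enum 'I_k,
      forall i, gcone s (c i *: realv R (tnth s i))}.
    by move=> i _; apply: gconeZ => //; apply: gcone_gen => //; exact: mem_tnth.
  exact: gcone_sum.
by move=> [c c0 ->]; exists (fun i => c (tnth s i)) => //; rewrite big_tuple.
Qed.

(** The value of the form at a point of the cone is a sum of nonnegative terms,
    one for each generator, so that it vanishes only if all of them do. *)
Lemma gcone_zero s (l : 'cV[R]_3) :
  {in s, forall v, 0 <= (realv R v *m l) 0 0} ->
  gcone s `&` [set x | (x *m l) 0 0 = 0] =
  gcone [seq v <- s | (realv R v *m l) 0 0 == 0].
Proof.
move=> l0; apply/seteqP; split => x /=.
  move=> [[c c0 ->]]; rewrite mulmx_suml summxE => /eqP.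
  rewrite big_seq psumr_eq0 => [|v vs]; last first.
    by rewrite -scalemxAl mxE mulr_ge0// l0.
  move=> /allP cl; exists c => //; rewrite big_filter [RHS]big_mkcond/=.
  rewrite big_seq [RHS]big_seq; apply: eq_bigr => v vs; case: ifPn => // lv.
  move: (cl v vs); rewrite /= vs -scalemxAl mxE mulf_eq0 (negPf lv) orbF.
  by move=> /eqP ->; rewrite scale0r.
move=> [c c0 ->]; split.
  exists (fun v => if (realv R v *m l) 0 0 == 0 then c v else 0).
    by move=> v; case: ifP.
  rewrite big_filter big_mkcond/=; apply: eq_bigr => v _.
  by case: ifP => // _; rewrite scale0r.
rewrite mulmx_suml summxE big_filter big1// => v /eqP lv.
by rewrite -scalemxAl mxE lv mulr0.
Qed.

Lemma gcone_form_ge0 s (l : 'cV[R]_3) x :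
  {in s, forall v, 0 <= (realv R v *m l) 0 0} -> gcone s x ->
  0 <= (x *m l) 0 0.
Proof.
move=> l0 [c c0 ->]; rewrite mulmx_suml summxE big_seq sumr_ge0// => v vs.
by rewrite -scalemxAl mxE mulr_ge0// l0.
Qed.

Lemma face_gcone s F : uniq s -> face (gcone s) F ->
  exists2 t, subseq t s & F = gcone t.
Proof.
move=> us [l l0 ->]; exists [seq v <- s | (realv R v *m l) 0 0 == 0].
  exact: filter_subseq.
by apply: gcone_zero => v vs; apply: l0; exact: gcone_gen.
Qed.

Lemma primitive_neq0 v : primitive v -> realv R v != 0.
Proof.
move=> pv; apply/eqP => v0; move: pv; rewrite /primitive.
have -> : v = 0 by apply: realv_inj; rewrite v0 /realv map_mx0.
by rewrite !big_ord_recl big_ord0 !mxE.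
Qed.

(** Two proportional vectors satisfy w_i v_j = w_j v_i, so multiplying the gcd
    of the coordinates of v by w_i gives the gcd of the coordinates of w times
    v_i up to sign. *)
Lemma primitive_ray v w : primitive v -> primitive w ->
  ray R v (realv R w) -> w = v.
Proof.
move=> pv pw [a a0 E].
have Ei i : (w 0 i)%:~R = a * (v 0 i)%:~R :> R.
  by rewrite -realvE E mxE realvE.
have Eij i j : w 0 i * v 0 j = w 0 j * v 0 i.
  apply: (@intr_inj R); rewrite !intrM !Ei; ring.
have gcdM (n : int) (u : lattice) :
    `|n| * \big[gcdz/0]_i u 0 i = \big[gcdz/0]_i (n * u 0 i).
  have gcd_abs (m p : int) : gcdz (n * m) p = gcdz (`|n| * m) p.
    by rewrite /gcdz !abszM; congr (gcdn (_ * _) _)%N; lia.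
  rewrite !big_ord_recl !big_ord0 !gcdz0 abszM PoszM !gcd_abs !abszE.
  by rewrite -!mulz_gcdr !abszE !normr_id.
have gcdN (n : int) (u : lattice) : primitive u ->
    `|n| = \big[gcdz/0]_i (n * u 0 i).
  by rewrite -gcdM => ->; rewrite mulr1.
have absE i : `|w 0 i| = `|v 0 i|.
  rewrite (gcdN _ v)// (gcdN _ w)//; apply: eq_bigr => j _.
  by rewrite Eij mulrC.
apply/rowP => i; apply: (@intr_inj R).
move: (absE i) => /(congr1 (intr : int -> R)).
rewrite !intr_norm Ei normrM (ger0_norm a0).
have [->|vi] := eqVneq ((v 0 i)%:~R : R) 0; first by rewrite mulr0.
rewrite -{2}[`|_|]mul1r => /mulIf -> //; first by rewrite mul1r.
by rewrite normr_eq0.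
Qed.

(** The ray of an extremal vector is spanned by the generators that it
    contains, and it contains only one primitive vector. *)
Lemma extremal_gcone s v : uniq s -> {in s, forall w, primitive w} ->
  extremal (gcone s) v -> v \in s.
Proof.
move=> us ps [pv /(face_gcone us)[t ts E]].
have ut : uniq t := subseq_uniq ts us.
have : ray R v (realv R v) by exists 1 => //; rewrite scale1r.
case: t => [|w t] in ts ut E *.
  rewrite E => -[c _]; rewrite big_nil => /eqP.
  by rewrite (negPf (primitive_neq0 pv)).
have ws : w \in s by rewrite (mem_subseq ts)// mem_head.
have <- // : w = v.
apply: (primitive_ray pv (ps _ ws)).
by rewrite E; apply: gcone_gen => //; exact: mem_head.
Qed.

(** * Unimodular triples *)

Notation realf := (map_mx (intr : int -> R)).

Definition gens (T : 3.-tuple lattice) : 'M[int]_3 :=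
  \matrix_(i, j) tnth T i 0 j.

Lemma form_realv v (l : 'cV[int]_3) :
  (realv R v *m realf l) 0 0 = ((v *m l) 0 0)%:~R.
Proof. by rewrite -map_mxM mxE. Qed.

(** The dual basis is made of the columns of the inverse matrix. It is indexed
    by lattice vectors, in order to be used with subsequences of T. *)
Lemma dual_basis (T : 3.-tuple lattice) : uniq T -> gens T \in unitmx ->
  exists D : lattice -> 'cV[int]_3,
    {in T &, forall v w, (v *m D w) 0 0 = (v == w)%:R} /\
    forall x : 'rV[R]_3, x = \sum_(v <- T) (x *m realf (D v)) 0 0 *: realv R v.
Proof.
move=> uT gT; pose W := invmx (gens T).
pose D v := col (inord (index v T)) W.
have idx (i : 'I_3) : inord (index (tnth T i) T) = i.
  apply: val_inj; rewrite /= inordK; last first.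
    by have := mem_tnth i T; rewrite -index_mem size_tuple.
  by rewrite (tnth_nth 0) index_uniq// size_tuple.
exists D; split.
  move=> v w /tnthP[i ->] /tnthP[j ->].
  have <- : (i == j) = (tnth T i == tnth T j).
    apply/eqP/eqP => [->//|].
    by move=> /(congr1 (fun v => inord (index v T) : 'I_3)); rewrite !idx.
  have := mulmxV gT; rewrite -/W => /matrixP/(_ i j).
  rewrite !mxE => <-; apply: eq_bigr => k _.
  by rewrite /D idx !mxE.
move=> x.
have E : realf W *m realf (gens T) = 1%:M.
  by rewrite -map_mxM /W mulVmx// map_mx1.
rewrite -[LHS]mulmx1 -E mulmxA mulmx_sum_row big_tuple.
apply: eq_bigr => i _; congr (_ *: _).
  rewrite mxE [RHS]mxE; apply: eq_bigr => j _; congr (_ * _).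
  by rewrite /D idx !mxE.
by apply/rowP => j; rewrite !mxE.
Qed.

(** The gcd divides every integer combination, in particular 1. *)
Lemma big_gcdz_eq1 (I : finType) (F c : I -> int) :
  \sum_i c i * F i = 1 -> \big[gcdz/0]_i F i = 1.
Proof.
move=> cF; set d := (X in X = 1).
have dvd i : (d %| F i)%Z.
  rewrite /d; have : i \in index_enum I by rewrite mem_index_enum.
  elim: (index_enum _) => // j r IH; rewrite inE big_cons.
  move=> /orP[/eqP <-|ir]; first exact: dvdz_gcdl.
  exact: (dvdz_trans (dvdz_gcdr _ _) (IH ir)).
have : (d %| \sum_i (c i * F i)%R)%Z.
  by apply: rpred_sum => i _; exact: dvdz_mull.
rewrite cF dvdz1 => /eqP d1.
have d0 : 0 <= d by rewrite /d; apply: (big_rec (fun m : int => 0 <= m)).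
by rewrite -(ger0_norm d0) -abszE d1.
Qed.

(** The determinant of a product is the sum, over all choices of rows of the
    second factor, of a coefficient times a minor of the second factor. So a
    left inverse makes the minors coprime. *)
Lemma coprime_minors k (M : 'M[int]_(3, k)) (N : 'M[int]_(k, 3)) :
  N *m M = 1%:M ->
  \big[gcdz/0]_(g : {ffun 'I_k -> 'I_3}) \det (rowsub g M) = 1.
Proof.
move=> NM; apply: (big_gcdz_eq1 (c := fun g : {ffun _ -> _} => \prod_i N i (g i))).
rewrite -[RHS](det1 _ k) -NM /determinant; symmetry.
under eq_bigr => s _.
  under [X in _ * X]eq_bigr => i _ do rewrite mxE.
  rewrite bigA_distr_bigA/= big_distrr/=.
  over.
rewrite exchange_big; apply: eq_bigr => g _; rewrite big_distrr/=.
apply: eq_bigr => s _; rewrite big_split/= mulrCA; congr (_ * (_ * _)).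
by apply: eq_bigr => i _; rewrite mxE.
Qed.

(** The faces of a unimodular triple: its dual basis reads off the coefficients
    and provides the linear forms that cut out the faces. *)
Section Simplex.
Variables (T : 3.-tuple lattice) (uT : uniq T) (gT : gens T \in unitmx).

Lemma unimodular_primitive v : v \in T -> primitive v.
Proof.
move=> vT; have [D [DT _]] := dual_basis uT gT.
apply: (big_gcdz_eq1 (c := fun i => D v i 0)).
transitivity ((v *m D v) 0 0); last by rewrite DT// eqxx.
by rewrite mxE; apply: eq_bigr => i _; rewrite mulrC.
Qed.

(** The sum of the dual forms of the other generators vanishes exactly on the
    face. *)
Lemma face_subset s t : subseq s T -> subseq t s -> face (gcone s) (gcone t).
Proof.
move=> sT ts; have [D [DT _]] := dual_basis uT gT.
pose l := \sum_(w <- s | w \notin t) realf (D w).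
have lE v : v \in s -> (realv R v *m l) 0 0 = (v \notin t)%:R.
  move=> vs; have vT := mem_subseq sT vs.
  have us := subseq_uniq sT uT.
  rewrite mulmx_sumr summxE.
  have -> : \sum_(w <- s | w \notin t) (realv R v *m realf (D w)) 0 0
     = \sum_(w <- s | w \notin t) (v == w)%:R :> R.
    rewrite [LHS]big_seq_cond [RHS]big_seq_cond.
    apply: eq_bigr => w /andP[ws _].
    by rewrite form_realv DT ?(mem_subseq sT ws)//; case: (_ == _).
  case: (boolP (v \in t)) => vt /=.
    by rewrite big1// => w wt; case: eqP => // vw; rewrite -vw vt in wt.
  rewrite big_mkcond (bigD1_seq v)//= vt eqxx big1 ?addr0// => w wv.
  by rewrite eq_sym (negPf wv); case: ifP.
have l0 v : v \in s -> 0 <= (realv R v *m l) 0 0.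
  by move=> vs; rewrite lE.
exists l => [x|]; first exact: gcone_form_ge0.
rewrite gcone_zero//; congr gcone.
rewrite (eq_in_filter (a2 := mem t)) => [|v vs].
  by apply/subseq_uniqP => //; exact: subseq_uniq sT uT.
by rewrite lE// pnatr_eq0 eqb0 negbK.
Qed.

Lemma extremal_subset s v : subseq s T -> v \in s <-> extremal (gcone s) v.
Proof.
move=> sT; have us := subseq_uniq sT uT; split => [vs|].
  split; first exact: unimodular_primitive (mem_subseq sT vs).
  by rewrite ray_gcone; apply: face_subset => //; rewrite sub1seq.
apply: extremal_gcone => // w ws.
exact: unimodular_primitive (mem_subseq sT ws).
Qed.

Lemma regular_subset s : subseq s T -> regular_cone (gcone s).
Proof.
move=> sT; have us := subseq_uniq sT uT.
have [D [DT _]] := dual_basis uT gT.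
exists (size s), (in_tuple s); split => //.
  by move=> v; apply: extremal_subset.
apply: (@coprime_minors _ _ (\matrix_(i, j) D (tnth (in_tuple s) i) j 0)).
apply/matrixP => i j; rewrite !mxE.
have sTi k : tnth (in_tuple s) k \in (T : seq _).
  by apply: (mem_subseq sT); exact: mem_tnth (in_tuple s).
have -> : (i == j) = (tnth (in_tuple s) j == tnth (in_tuple s) i).
  rewrite !(tnth_nth 0) nth_uniq//.
  by rewrite eq_sym.
rewrite -DT// mxE; apply: eq_bigr => k _; rewrite !mxE mulrC//.
Qed.
End Simplex.
End Cones.
Arguments gcone : clear implicits.

(** * Complete fans from regular triangulations *)

Section TableFan.
Variable R : realType.
Implicit Types (x : 'rV[R]_3) (s t : seq lattice).
Local Notation realf := (map_mx (intr : int -> R)).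
Local Notation entry := (3.-tuple lattice * 'cV[int]_3)%type.

(** In other words, the maximum of the forms attached to the triangles is a
    convex function that is linear on the cone over each triangle and on no
    larger cone. *)
Definition convex_table (tab : seq entry) :=
  {in tab &, forall p q : entry, {in p.1, forall v : lattice,
    (v *m q.2) 0 0 <= (v *m p.2) 0 0 ?= iff (v \in q.1)}}.

(** A union of triangles whose boundary lies on the coordinate planes is a
    section of the whole orthant. *)
Definition closed_table (tab : seq entry) :=
  {in tab, forall p : entry, {in p.1, forall v : lattice,
    (exists i, {in p.1, forall u : lattice, u != v -> u 0 i = 0}) \/
    (exists2 q, q \in tab &
       v \notin q.1 /\ {in p.1, forall u : lattice, u != v -> u \in q.1})}}.

Definition table_fan (tab : seq entry) : set (set 'rV[R]_3) :=
  [set C | exists p s, [/\ p \in tab, subseq s p.1 & C = gcone R s]].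

Lemma seq_max (I : eqType) (f : I -> R) (r : seq I) : r != [::] ->
  exists2 i, i \in r & {in r, forall j, f j <= f i}.
Proof.
elim: r => // i [|j r] IH _.
  by exists i; rewrite ?mem_head// => k; rewrite inE => /eqP ->.
have [//|k kr kmax] := IH.
have [ik|ki] := leP (f i) (f k).
  exists k; first by rewrite inE kr orbT.
  by move=> h; rewrite inE => /orP[/eqP ->//|]; exact: kmax.
exists i; first exact: mem_head.
move=> h; rewrite inE => /orP[/eqP ->//|/kmax/le_trans->//]; exact: ltW.
Qed.

Variable tab : seq entry.
Hypothesis tab_neq0 : tab != [::].
Hypothesis tab_uniq : {in tab, forall p : entry, uniq p.1}.
Hypothesis tab_unimodular : {in tab, forall p : entry, gens p.1 \in unitmx}.
Hypothesis tab_ge0 :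
  {in tab, forall p : entry, {in p.1, forall (v : lattice) i, 0 <= v 0 i}}.
Hypothesis tab_convex : convex_table tab.
Hypothesis tab_closed : closed_table tab.

(** The form of p minus the form of q is nonnegative on the generators of p and
    at most 0 on those of q, so it vanishes at x. As it is positive on the
    generators of p that q does not have, these have coefficient zero. *)
Lemma table_common p q s x : p \in tab -> q \in tab -> subseq s p.1 ->
  gcone R s x -> gcone R q.1 x -> gcone R [seq v <- s | v \in q.1] x.
Proof.
move=> ptab qtab sp sx qx.
pose l := realf (p.2 - q.2).
have lE v : (realv R v *m l) 0 0 = ((v *m p.2) 0 0 - (v *m q.2) 0 0)%:~R.
  by rewrite form_realv mulmxBr !mxE.
have l0 v : v \in s -> 0 <= (realv R v *m l) 0 0.
  move=> vs; rewrite lE ler0z subr_ge0.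
  exact: (tab_convex ptab qtab (mem_subseq sp vs)).1.
have lx : (x *m l) 0 0 = 0.
  apply/eqP; rewrite eq_le (gcone_form_ge0 l0 sx) andbT.
  rewrite -oppr_ge0.
  have -> : - (x *m l) 0 0 = (x *m - l) 0 0 by rewrite mulmxN [RHS]mxE.
  apply: gcone_form_ge0 qx => v vq.
  rewrite mulmxN mxE lE oppr_ge0 lerz0 subr_le0.
  exact: (tab_convex qtab ptab vq).1.
have := gcone_zero l0 => E.
have : (gcone R s `&` [set x | (x *m l) 0 0 = 0]) x by [].
rewrite E; congr (gcone R _ x); apply: eq_in_filter => v vs.
rewrite lE intr_eq0 subr_eq0 eq_sym.
exact: (tab_convex ptab qtab (mem_subseq sp vs)).2.
Qed.

Lemma table_meet p q s t : p \in tab -> q \in tab -> subseq s p.1 ->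
  subseq t q.1 -> gcone R s `&` gcone R t = gcone R [seq v <- s | v \in t].
Proof.
move=> ptab qtab sp tq.
have us := subseq_uniq sp (tab_uniq ptab).
have ut := subseq_uniq tq (tab_uniq qtab).
apply/seteqP; split => x.
  move=> [sx tx].
  have px : gcone R p.1 x.
    by apply: gcone_sub sx; [exact: tab_uniq|exact: mem_subseq].
  have [c c0 cx] := table_common qtab ptab tq tx px.
  have [D [DT Dx]] := dual_basis R (tab_uniq ptab) (tab_unimodular ptab).
  (* A generator of s outside t has coefficient zero: x is also a combination
     of generators of t that belong to p. *)
  have [e e0 ex] := sx.
  have De v : v \in (p.1 : seq _) ->
      (x *m realf (D v)) 0 0 = if v \in s then e v else 0.
    move=> vp; rewrite ex mulmx_suml summxE.
    under eq_big_seq => u us'.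
      rewrite -scalemxAl mxE form_realv DT//; last exact: (mem_subseq sp).
    over.
    case: ifPn => vs.
      rewrite (bigD1_seq v)//= eqxx mulr1 big1 ?addr0// => u /negPf ->.
      by rewrite mulr0.
    rewrite big_seq big1// => u us'; case: eqP => [uv|_]; last by rewrite mulr0.
    by rewrite -uv us' in vs.
  have Dc v : v \in s -> v \notin t -> e v = 0.
    move=> vs vt; have := De v (mem_subseq sp vs); rewrite vs => <-.
    rewrite cx mulmx_suml summxE big_seq big1// => u.
    rewrite mem_filter => /andP[up ut']; rewrite -scalemxAl mxE form_realv DT//.
      by case: eqP => [uv|_]; [rewrite -uv ut' in vt|rewrite mulr0].
    exact: (mem_subseq sp).
  exists e => //; rewrite ex big_filter [RHS]big_mkcond.
  apply: eq_big_seq => v vs; case: ifPn => // vt.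
  by rewrite Dc// scale0r.
move=> fx; split; apply: gcone_sub fx => // v; rewrite mem_filter => /andP[]//.
Qed.

(** The cone that contains x is the one whose form is largest at x. A negative
    coefficient of x on a generator v would make the form of the triangle
    across the side opposite to v larger, as the two forms agree on this
    side. *)
Lemma table_cover x : orthant R x -> exists2 p, p \in tab & gcone R p.1 x.
Proof.
move=> x0.
have [p ptab pmax] :=
  seq_max (fun p : entry => (x *m realf p.2) 0 0) tab_neq0.
exists p => //.
have up := tab_uniq ptab.
have [D [DT Dx]] := dual_basis R up (tab_unimodular ptab).
rewrite (Dx x); apply: gcone_sum => v vp; apply: gconeZ; last exact: gcone_gen.
have xE (l : 'cV[R]_3) :
    {in p.1, forall u : lattice, u != v -> (realv R u *m l) 0 0 = 0} ->
    forall y : 'rV[R]_3, (y *m l) 0 0 =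
      (y *m realf (D v)) 0 0 * (realv R v *m l) 0 0.
  move=> lu y; rewrite {1}(Dx y) mulmx_suml summxE.
  rewrite (bigD1_seq v)//= -scalemxAl mxE big_seq_cond big1 ?addr0//.
  by move=> u /andP[pu uv]; rewrite -scalemxAl mxE lu// mulr0.
have [[i iv]|[q qtab [vq pq]]] := tab_closed ptab vp.
  have iE (y : 'rV[R]_3) : (y *m (delta_mx i 0 : 'cV_3)) 0 0 = y 0 i.
    rewrite mxE (bigD1 i)//= mxE !eqxx mulr1 big1 ?addr0// => j /negPf ji.
    by rewrite mxE ji mulr0.
  have {}xE (y : 'rV[R]_3) : y 0 i = (y *m realf (D v)) 0 0 * (v 0 i)%:~R.
    rewrite -iE (xE (delta_mx i 0)) ?iE ?realvE// => u up' uv.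
    by rewrite iE realvE iv.
  have vi : (0 : R) < (v 0 i)%:~R.
    rewrite lt_neqAle ler0z (tab_ge0 ptab vp) andbT eq_sym; apply/eqP => vi0.
    have := xE (delta_mx 0 i); rewrite vi0 mulr0 mxE !eqxx => /eqP.
    by rewrite oner_eq0.
  by rewrite -(pmulr_lge0 _ vi) -xE; exact: x0.
have lE (y : 'rV[R]_3) : (y *m realf (q.2 - p.2)) 0 0 =
    (y *m realf q.2) 0 0 - (y *m realf p.2) 0 0.
  by rewrite map_mxB mulmxBr !mxE.
have := pmax q qtab; rewrite -subr_le0 -lE xE; last first.
  move=> u up' uv; apply/eqP; rewrite lE subr_eq0 !form_realv eqr_int.
  by rewrite (tab_convex ptab qtab up').2 pq.
rewrite nmulr_lle0// lE !form_realv subr_lt0 ltr_int.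
by rewrite (lt_leif (tab_convex ptab qtab vp)).
Qed.

Lemma table_fan_sub p : p \in tab -> table_fan tab (gcone R p.1).
Proof. by move=> ptab; exists p, p.1; split. Qed.

Lemma table_fan_orthant C : table_fan tab C -> C `<=` orthant R.
Proof.
move=> [p [s [ptab sp ->]]]; apply: gcone_orthant => v vs i.
by apply: tab_ge0 ptab _ _ _; exact: (mem_subseq sp).
Qed.

Lemma table_fan_fan : fan (table_fan tab).
Proof.
split.
- pose sides (p : entry) : seq (seq lattice) :=
    [seq mask (tval m) (tval p.1) | m <- enum {: 3.-tuple bool}].
  have : finite_set (gcone R @` [set` flatten [seq sides p | p <- tab]]).
    exact/finite_image/finite_seq.
  apply: sub_finite_set => _ [p [s [ptab sp ->]]]; exists s => //=.
  apply/flattenP; exists (sides p); first by apply/mapP; exists p.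
  have [m ms ->] := subseqP sp.
  have m3 : size m == 3 by rewrite ms size_tuple.
  by apply/mapP; exists (Tuple m3) => //; rewrite mem_enum.
- move=> _ [p [s [ptab sp ->]]]; exists (size s), (in_tuple s).
  by rewrite cone_of_gcone//; exact: subseq_uniq sp (tab_uniq ptab).
- move=> C CS x Cx CNx; apply/rowP => i; rewrite mxE; apply/eqP.
  rewrite eq_le (table_fan_orthant CS Cx) andbT.
  by have := table_fan_orthant CS CNx i; rewrite mxE oppr_ge0.
- move=> _ F [p [s [ptab sp ->]]] /face_gcone[].
    exact: subseq_uniq sp (tab_uniq ptab).
  move=> t ts ->; exists p, t; split=> //; exact: subseq_trans ts sp.
- move=> _ _ [p [s [ptab sp ->]]] [q [t [qtab tq ->]]].
  rewrite (table_meet ptab qtab sp tq).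
  apply: (face_subset R (tab_uniq ptab) (tab_unimodular ptab) sp).
  exact: filter_subseq.
Qed.

Lemma table_fan_regular C : table_fan tab C -> regular_cone C.
Proof.
move=> [p [s [ptab sp ->]]].
exact: (regular_subset R (tab_uniq ptab) (tab_unimodular ptab)).
Qed.

Lemma table_fan_cover : \bigcup_(C in table_fan tab) C = orthant R.
Proof.
apply/seteqP; split => x.
  by move=> [C /table_fan_orthant]; exact.
move=> /table_cover[p ptab px]; exists (gcone R p.1) => //.
exact: table_fan_sub.
Qed.

Lemma table_fan_rays :
  rays (table_fan tab) = [set v | exists2 p, p \in tab & v \in p.1].
Proof.
apply/seteqP; split => v.
  move=> [pv [p [s [ptab sp E]]]]; exists p => //.
  apply: (mem_subseq sp).
  apply/(extremal_subset R (tab_uniq ptab) (tab_unimodular ptab) v sp).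
  split=> //; rewrite -E; exists 0 => [x _|]; first by rewrite mulmx0 mxE.
  by apply/seteqP; split => [x ?|x []//]; split=> //=; rewrite mulmx0 mxE.
move=> [p ptab vp]; split.
  exact: (unimodular_primitive R (tab_uniq ptab) (tab_unimodular ptab)).
by exists p, [:: v]; rewrite ray_gcone sub1seq.
Qed.

End TableFan.
Arguments table_fan : clear implicits.

(** * Groebner cones *)

Section GroebnerCones.
Variable R : realType.
Implicit Types (v w : 'rV[R]_3) (f : {mpoly R[i][3]}) (m : 'X_{1..3}).

Lemma weightD v w m : weight (v + w) m = weight v m + weight w m.
Proof. by rewrite -big_split; apply: eq_bigr => i _; rewrite mxE mulrDl. Qed.

Lemma weightZ (a : R) v m : weight (a *: v) m = a * weight v m.
Proof. by rewrite mulr_sumr; apply: eq_bigr => i _; rewrite mxE mulrA. Qed.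

Lemma order_at_le v f m : m \in msupp f -> order_at v f <= weight v m.
Proof. by move=> mf; apply: ge_bigmin_seq. Qed.

Lemma order_at_attained v f : f != 0 ->
  exists2 m, m \in msupp f & weight v m = order_at v f.
Proof.
have bigmin_in (x0 : R) (r : seq 'X_{1..3}) F :
    \big[Num.min/x0]_(m <- r) F m \in x0 :: map F r.
  elim: r => [|m r IH]; first by rewrite big_nil mem_head.
  rewrite big_cons !inE; case: leP => _; first by rewrite eqxx orbT.
  by move: IH; rewrite inE => /orP[->//|->]; rewrite !orbT.
move=> f0; have : msupp f != [::] by rewrite msupp_eq0.
have := bigmin_in (weight v (head 0%MM (msupp f))) (msupp f) (weight v).
rewrite -/(order_at v f); case: (msupp f) => // m s.
rewrite inE => /orP[/eqP ->|/mapP[m' ms ->]] _.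
  by exists m; rewrite ?mem_head.
by exists m'.
Qed.

Lemma initial_form_coef v f m :
  (initial_form v f)@_m = if weight v m == order_at v f then f@_m else 0.
Proof.
rewrite /initial_form -big_filter.
rewrite (raddf_sum (mcoeff m)) big_filter /=.
case: (boolP (m \in msupp f)) => mf.
  rewrite big_mkcond (bigD1_seq m)//= ?msupp_uniq//.
  rewrite big1 ?addr0 => [|m' m'm].
    by case: ifP => // _; rewrite mcoeffZ mcoeffX eqxx mulr1.
  by case: ifP => // _; rewrite mcoeffZ mcoeffX (negPf m'm) mulr0.
rewrite (memN_msupp_eq0 mf) if_same big_seq_cond big1// => m' /andP[m'f _].
rewrite mcoeffZ mcoeffX; case: eqP => [E|_]; last by rewrite mulr0.
by rewrite -E m'f in mf.
Qed.

Lemma initial_form_eqP v w f : initial_form v f = initial_form w f <->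
  {in msupp f, forall m,
    (weight v m == order_at v f) = (weight w m == order_at w f)}.
Proof.
split=> [E m mf|E].
  have := congr1 (mcoeff m) E; rewrite !initial_form_coef.
  move: mf; rewrite mcoeff_msupp => /negPf fm.
  by do 2!case: ifP => // _; move/eqP; rewrite ?fm// eq_sym fm.
apply/mpolyP => m; rewrite !initial_form_coef.
case: (boolP (m \in msupp f)) => mf; first by rewrite E.
by rewrite (memN_msupp_eq0 mf) !if_same.
Qed.

Lemma weight_continuous m : continuous (fun v => weight v m).
Proof.
rewrite /weight; elim: (index_enum _) => [|i s IH] v.
  under eq_fun do rewrite big_nil; exact: cst_continuous.
under eq_fun do rewrite big_cons.
apply: (@continuousD R R^o _ (fun v => v 0 i * (m i)%:R)); last exact: IH.
apply: (@continuousM R _ (fun v => v 0 i)).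
  exact: coord_continuous.
exact: cst_continuous.
Qed.

(** If the terms that are minimal at v are minimal at w too, then they are
    exactly the minimal terms at w + e v for all e > 0, and w is the limit of
    these points. *)
Lemma groebner_coneE f v : f != 0 -> orthant R v -> groebner_cone f v =
  [set w | orthant R w /\ {in msupp f &, forall m n,
     weight v m = order_at v f -> weight w m <= weight w n}].
Proof.
move=> f0 v0; apply/seteqP; split => w.
  rewrite /groebner_cone closureE; apply.
  split=> [|u [u0 /initial_form_eqP uv]]; last first.
    split=> // m n mf nf vm; have := uv m mf; rewrite vm eqxx => /eqP ->.
    exact: order_at_le.
  have -> : [set w | orthant R w /\ {in msupp f &, forall m n,
       weight v m = order_at v f -> weight w m <= weight w n}] =
     (\bigcap_(i in [set: 'I_3]) [set w : 'rV[R]_3 | 0 <= w 0 i]) `&`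
     (\bigcap_(mn in [set mn : 'X_{1..3} * 'X_{1..3} |
                       [/\ mn.1 \in msupp f, mn.2 \in msupp f &
                           weight v mn.1 = order_at v f]])
        [set w | 0 <= weight w mn.2 - weight w mn.1]).
    apply/seteqP; split => u.
      move=> [u0 fu]; split=> [i _|[m n] /= [mf nf vm]]; first exact: u0.
      by rewrite subr_ge0 fu.
    move=> [u0 fu]; split=> [i|m n mf nf vm]; first exact: u0.
    by rewrite -subr_ge0; apply: (fu (m, n)).
  apply: closedI;
    [apply: closed_bigI => i _|apply: closed_bigI => -[m n] _] => /=.
    apply: (@closed_comp _ _ (fun u : 'rV[R]_3 => u 0 i) [set r : R | 0 <= r]).
      by move=> u _; exact: coord_continuous.
    exact: closed_ge.
  apply: (@closed_comp _ _ (fun u : 'rV[R]_3 => weight u n - weight u m)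
    [set r : R | 0 <= r]).
    by move=> u _; apply: (@continuousB R R^o); exact: weight_continuous.
  exact: closed_ge.
move=> [w0 fw] B Bw.
pose g (e : R) := w + e *: v.
have gw : g e @[e --> 0^'+] --> w.
  rewrite -[X in _ --> X]addr0 -(scale0r v); apply: cvgD; first exact: cvg_cst.
  apply: cvgZr_tmp; apply: cvg_at_right_filter; exact: cvg_id.
have gB : \forall e \near (0 : R)^'+, B (g e) by apply: gw.
near (0 : R)^'+ => e.
have Be : B (g e) by near: e; exact: gB.
have e0 : 0 < e by near: e; exact: nbhs_right_gt.
exists (g e); split=> //; split.
  by move=> i; rewrite !mxE addr_ge0// mulr_ge0// ltW.
have [m mf vm] := order_at_attained v f0.
have gE : order_at (g e) f = weight w m + e * order_at v f.
  have [n nf vn] := order_at_attained (g e) f0.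
  apply/eqP; rewrite eq_le; apply/andP; split.
    by rewrite -vm -weightZ -weightD; exact: order_at_le.
  rewrite -vn weightD weightZ lerD ?fw// ler_pM2l//; exact: order_at_le.
apply/initial_form_eqP => n nf; rewrite gE weightD weightZ.
have wn := fw m n mf nf vm; have vn := order_at_le v nf.
apply/eqP/eqP => [E|vnE]; last first.
  by rewrite vnE; congr (_ + _); apply/le_anti; rewrite wn fw.
apply/le_anti; rewrite vn andbT -(ler_pM2l e0).
by move: E wn => /=; lra.
Unshelve. all: by end_near. Qed.

Lemma groebner_cone_id f v : orthant R v -> groebner_cone f v v.
Proof. by move=> v0; apply: subset_closure. Qed.

Lemma groebner_cover f : \bigcup_(C in groebner_fan f) C = orthant R.
Proof.
apply/seteqP; split => w.
  move=> [_ [v v0 <-]]; rewrite /groebner_cone closureE.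
  apply; split=> [|u []//].
  have -> : orthant R =
      \bigcap_(i in [set: 'I_3]) [set w : 'rV[R]_3 | 0 <= w 0 i].
    by apply/seteqP; split => u u0 i; [move=> _|]; exact: u0.
  apply: closed_bigI => i _.
  apply: (@closed_comp _ _ (fun u : 'rV[R]_3 => u 0 i) [set r : R | 0 <= r]).
    by move=> u _; exact: coord_continuous.
  exact: closed_ge.
move=> w0; exists (groebner_cone f w); last exact: groebner_cone_id.
by exists w.
Qed.

End GroebnerCones.

(** * A unimodular triangulation of the profiles *)

Section Coordinates.

Lemma ord3P (P : 'I_3 -> Prop) : P 0 -> P 1 -> P 2 -> forall i, P i.
Proof.
by move=> P0 P1 P2 [[|[|[|i]]] // iP]; [move: P0|move: P1|move: P2];
  congr P; apply: val_inj.
Qed.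

Lemma sum3 (V : nmodType) (F : 'I_3 -> V) : \sum_i F i = F 0 + F 1 + F 2.
Proof.
rewrite !big_ord_recl big_ord0 addr0 addrA.
by congr (F _ + F _ + F _); apply: val_inj.
Qed.

Lemma row3P (K : Type) (x y : 'rV[K]_3) :
  x 0 0 = y 0 0 -> x 0 1 = y 0 1 -> x 0 2 = y 0 2 -> x = y.
Proof. by move=> *; apply/rowP; apply: ord3P. Qed.

End Coordinates.

(** Matrices do not reduce under evaluation: the finite checks are made on
    triples of integers. *)
Definition tri : Type := int * int * int.
Definition vec (t : tri) : lattice := \row_i [:: t.1.1; t.1.2; t.2]`_i.
Definition form (t : tri) : 'cV[int]_3 := \col_i [:: t.1.1; t.1.2; t.2]`_i.
Definition dot (s t : tri) : int := s.1.1 * t.1.1 + s.1.2 * t.1.2 + s.2 * t.2.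
Definition cross (s t : tri) : tri :=
  (s.1.2 * t.2 - s.2 * t.1.2, s.2 * t.1.1 - s.1.1 * t.2,
   s.1.1 * t.1.2 - s.1.2 * t.1.1).

Lemma vec_inj : injective vec.
Proof.
move=> [[a b] c] [[a' b'] c'] /rowP E.
by move: (E 0) (E 1) (E 2); rewrite !mxE /= => -> -> ->.
Qed.

Lemma vec_surj (v : lattice) : v = vec (v 0 0, v 0 1, v 0 2).
Proof. by apply: (@row3P int); rewrite mxE. Qed.

Lemma vec_form s t : (vec s *m form t) 0 0 = dot s t.
Proof. by rewrite mxE sum3 !mxE. Qed.

(** The inverse of the matrix of three rows is made of their cross products,
    up to the determinant. *)
Lemma gens_unitmx (T : 3.-tuple tri) :
  dot (tnth T 0) (cross (tnth T 1) (tnth T 2)) ^+ 2 = 1 ->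
  gens (map_tuple vec T) \in unitmx.
Proof.
set a := tnth T 0; set b := tnth T 1; set c := tnth T 2.
move=> d1; set d := dot a (cross b c) in d1.
pose W : 'M[int]_3 := d *: \matrix_(i, j)
  form (nth a [:: cross b c; cross c a; cross a b] j) i 0.
suff : gens (map_tuple vec T) *m W = 1%:M by case/mulmx1_unit.
apply/matrixP; apply: ord3P; apply: ord3P;
  rewrite mxE sum3 !mxE !tnth_map -/a -/b -/c !mxE /= ?mulr0n;
  rewrite -?d1 /d /dot /cross /=; ring.
Qed.

Local Notation entry := (3.-tuple tri * tri)%type.

(** The first 13 triangles cover the profile of the cone where x^2 is minimal,
    the next 6 that of y^3 and the last 8 that of y z^3. The forms come from a
    height function on the lattice points of the profiles: the form of a
    triangle takes the prescribed heights at its vertices, and smaller values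
    than the heights at all other points. *)
Definition E7_triangles : seq (3.-tuple tri * tri) :=
  [:: ([tuple (0, 0, 1); (0, 1, 0); (1, 1, 1)], (-15, 16, 10));
     ([tuple (0, 0, 1); (1, 1, 1); (3, 2, 2)], (-12, 13, 10));
     ([tuple (0, 1, 0); (1, 1, 1); (2, 2, 1)], (-14, 16, 9));
     ([tuple (0, 1, 0); (1, 2, 0); (3, 3, 1)], (-9, 16, -2));
     ([tuple (0, 1, 0); (2, 2, 1); (3, 3, 1)], (-10, 16, 1));
     ([tuple (1, 1, 1); (2, 2, 1); (3, 2, 2)], (-12, 14, 9));
     ([tuple (2, 2, 1); (3, 2, 2); (4, 3, 2)], (-10, 13, 7));
     ([tuple (2, 2, 1); (3, 3, 1); (5, 4, 2)], (-9, 15, 1));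
     ([tuple (2, 2, 1); (4, 3, 2); (5, 4, 2)], (-9, 13, 5));
     ([tuple (3, 2, 2); (4, 3, 2); (6, 4, 3)], (-8, 11, 6));
     ([tuple (4, 3, 2); (5, 4, 2); (6, 4, 3)], (-7, 11, 4));
     ([tuple (5, 4, 2); (6, 4, 3); (7, 5, 3)], (-3, 8, 0));
     ([tuple (6, 4, 3); (7, 5, 3); (9, 6, 4)], (0, 5, -2));
     ([tuple (0, 0, 1); (1, 0, 0); (2, 1, 1)], (6, -17, 10));
     ([tuple (0, 0, 1); (2, 1, 1); (3, 2, 2)], (0, -5, 10));
     ([tuple (1, 0, 0); (2, 1, 1); (5, 3, 2)], (6, -4, -3));
     ([tuple (2, 1, 1); (3, 2, 2); (6, 4, 3)], (0, -1, 6));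
     ([tuple (2, 1, 1); (5, 3, 2); (6, 4, 3)], (3, -1, 0));
     ([tuple (5, 3, 2); (6, 4, 3); (9, 6, 4)], (2, 2, -2));
     ([tuple (1, 0, 0); (1, 1, 0); (3, 2, 1)], (6, 5, -17));
     ([tuple (1, 0, 0); (3, 2, 1); (5, 3, 2)], (6, 4, -15));
     ([tuple (1, 1, 0); (1, 2, 0); (3, 3, 1)], (-1, 12, -14));
     ([tuple (1, 1, 0); (3, 2, 1); (5, 4, 2)], (5, 6, -16));
     ([tuple (1, 1, 0); (3, 3, 1); (5, 4, 2)], (1, 10, -14));
     ([tuple (3, 2, 1); (5, 3, 2); (5, 4, 2)], (5, 5, -14));
     ([tuple (5, 3, 2); (5, 4, 2); (7, 5, 3)], (3, 5, -9));
     ([tuple (5, 3, 2); (7, 5, 3); (9, 6, 4)], (2, 4, -5))].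

Definition E7_table :=
  [seq (map_tuple vec p.1, form p.2) | p : entry <- E7_triangles].

Definition E7_points : seq tri :=
  undup (flatten [seq (p.1 : seq tri) | p : entry <- E7_triangles]).

Lemma E7_table_convex : convex_table E7_table.
Proof.
have chk : all (fun p : entry => all (fun q : entry => all (fun v : tri =>
    (dot v q.2 <= dot v p.2) &&
    ((dot v q.2 == dot v p.2) == (v \in (q.1 : seq tri))))
  (p.1 : seq tri)) E7_triangles) E7_triangles by vm_compute.
move=> _ _ /mapP[p pE ->] /mapP[q qE ->] _ /mapP[v vp ->] /=.
have /andP[le /eqP eq] := allP (allP (allP chk p pE) q qE) v vp.
clear pE qE chk; split; rewrite !vec_form; first exact: le.
by rewrite eq (mem_map vec_inj).
Qed.

Lemma E7_table_closed : closed_table E7_table.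
Proof.
have chk : all (fun p : entry => all (fun v : tri =>
   let r := [seq u <- (p.1 : seq tri) | u != v] in
   [|| all (fun u : tri => u.1.1 == 0) r, all (fun u : tri => u.1.2 == 0) r,
       all (fun u : tri => u.2 == 0) r |
       has (fun q : entry => (v \notin (q.1 : seq tri)) &&
         all (fun u => u \in (q.1 : seq tri)) r) E7_triangles])
  (p.1 : seq tri)) E7_triangles by vm_compute.
move=> _ /mapP[p pE ->] _ /mapP[v vp ->] /=.
have rP (P : pred tri) : all P [seq u <- (p.1 : seq tri) | u != v] ->
    {in [seq vec u | u <- (p.1 : seq tri)], forall u', u' != vec v ->
       exists2 u, u' = vec u & P u}.
  clear pE chk; move=> /allP Pp _ /mapP[u up ->] uv; exists u => //; apply: Pp.
  by rewrite mem_filter up andbT; apply: contra uv => /eqP ->.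
have := allP (allP chk p pE) v vp.
move=> /or4P[/rP c|/rP c|/rP c|/hasP[q qE /andP[vq /rP c]]].
- by left; exists 0 => u' up uv; have [u -> /eqP u0] := c _ up uv; rewrite mxE.
- by left; exists 1 => u' up uv; have [u -> /eqP u0] := c _ up uv; rewrite mxE.
- by left; exists 2 => u' up uv; have [u -> /eqP u0] := c _ up uv; rewrite mxE.
right; exists (map_tuple vec q.1, form q.2); first by apply/mapP; exists q.
clear chk pE qE; split; first by rewrite (mem_map vec_inj).
by move=> u' up uv; have [u -> uq] := c _ up uv; rewrite map_f.
Qed.

Lemma E7_table_uniq :
  {in E7_table, forall p : 3.-tuple lattice * 'cV_3, uniq p.1}.
Proof.
have chk : all (fun p : entry => uniq (p.1 : seq tri)) E7_triangles.
  by vm_compute.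
move=> _ /mapP[p pE ->] /=; rewrite map_inj_uniq; last exact: vec_inj.
exact: (allP chk).
Qed.

Lemma E7_table_ge0 : {in E7_table, forall p : 3.-tuple lattice * 'cV_3,
  {in p.1, forall (v : lattice) i, 0 <= v 0 i}}.
Proof.
have chk : all (fun p : entry => all (fun v : tri =>
  [&& 0 <= v.1.1, 0 <= v.1.2 & 0 <= v.2]) (p.1 : seq tri)) E7_triangles.
  by vm_compute.
move=> _ /mapP[p pE ->] _ /mapP[v vp ->] /=.
have /and3P[v0 v1 v2] := allP (allP chk p pE) v vp.
by apply: ord3P; rewrite mxE.
Qed.

Lemma E7_table_unimodular :
  {in E7_table, forall p : 3.-tuple lattice * 'cV_3, gens p.1 \in unitmx}.
Proof.
have chk : all (fun p : entry =>
  dot (tnth p.1 0) (cross (tnth p.1 1) (tnth p.1 2)) ^+ 2 == 1)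
  E7_triangles by vm_compute.
by move=> _ /mapP[p pE ->] /=; apply: gens_unitmx; exact/eqP/(allP chk).
Qed.

Lemma E7_points_table v : (exists2 p, p \in E7_table & v \in p.1) <->
  exists2 t, t \in E7_points & v = vec t.
Proof.
split=> [[_ /mapP[p pE ->] /= /mapP[t tp ->]]|[t]].
  exists t => //; rewrite mem_undup.
  apply/flattenP; exists (p.1 : seq tri) => //.
  by apply/mapP; exists p.
rewrite mem_undup => /flattenP[_ /mapP[p pE ->] tp ->].
exists (map_tuple vec p.1, form p.2); first exact: map_f.
exact: map_f.
Qed.

(** * The Groebner fan of E7 and its profiles *)

Definition mon (k : 'I_3) : 'X_{1..3} :=
  nth 0%MM [:: U_(0%R) *+ 2; U_(1%R) *+ 3; U_(1%R) + U_(2%R) *+ 3]%MM k.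

Section GroebnerFanE7.
Variable R : realType.
Implicit Types (x w : 'rV[R]_3) (v : lattice) (k : 'I_3).

Lemma E7E : E7 R = 'X_[mon 0] + 'X_[mon 1] + 'X_[mon 2].
Proof. by rewrite /E7 /mon /= mpolyXD !mpolyXn. Qed.

Lemma E7_coef m : (E7 R)@_m = #|[pred k | mon k == m]|%:R.
Proof.
rewrite E7E !mcoeffD !mcoeffX -sum1_card big_mkcond sum3 /=.
by rewrite !natrD; congr (_ + _ + _); case: eqP.
Qed.

Lemma mem_E7 m : (m \in msupp (E7 R)) = [exists k, mon k == m].
Proof. by rewrite mcoeff_msupp E7_coef pnatr_eq0. Qed.

Lemma mem_mon k : mon k \in msupp (E7 R).
Proof. by rewrite mem_E7; apply/existsP; exists k. Qed.

Lemma E7_neq0 : E7 R != 0.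
Proof. by rewrite -msupp_eq0; have := mem_mon 0; case: (msupp _). Qed.

Definition wt v k : int := \sum_i v 0 i * (mon k i)%:Z.

Lemma weight_realv v k : weight (realv R v) (mon k) = (wt v k)%:~R.
Proof.
rewrite /wt rmorph_sum; apply: eq_bigr => i _.
by rewrite realvE rmorphM.
Qed.

Lemma weight_mon x :
  (weight x (mon 0) = 2 * x 0 0) * (weight x (mon 1) = 3 * x 0 1) *
  (weight x (mon 2) = x 0 1 + 3 * x 0 2).
Proof.
by rewrite /weight !sum3 /mon /= !mnmE; split; [split|] => /=; ring.
Qed.

Lemma wt_mon v :
  (wt v 0 = 2 * v 0 0) * (wt v 1 = 3 * v 0 1) * (wt v 2 = v 0 1 + 3 * v 0 2).
Proof.
by rewrite /wt !sum3 /mon /= !mnmE; split; [split|] => /=; ring.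
Qed.

(** These are the three maximal Groebner cones. *)
Definition mcone k : set 'rV[R]_3 :=
  [set x | orthant R x /\ forall j, weight x (mon k) <= weight x (mon j)].

Lemma E7_min x : orthant R x -> exists k, mcone k x.
Proof.
move=> x0; have [m + xm] := order_at_attained x E7_neq0.
rewrite mem_E7 => /existsP[k /eqP km]; exists k; split=> // j.
by rewrite km xm order_at_le// mem_mon.
Qed.

Lemma E7_coneE x : orthant R x -> groebner_cone (E7 R) x =
  [set w | orthant R w /\ forall k, mcone k x -> mcone k w].
Proof.
move=> x0; rewrite (groebner_coneE E7_neq0 x0); apply/seteqP.
have orderE k : weight x (mon k) = order_at x (E7 R) <-> mcone k x.
  split=> [xk|[_ xk]]; first by split=> // j; rewrite xk order_at_le// mem_mon.
  have [m + xm] := order_at_attained x E7_neq0.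
  rewrite mem_E7 => /existsP[i /eqP im]; apply/le_anti.
  by rewrite order_at_le ?mem_mon// -xm -im xk.
split=> w [w0 xw]; split=> //.
  by move=> k /orderE xk; split=> // j; apply: xw; rewrite ?mem_mon.
move=> m n; rewrite !mem_E7 => /existsP[k /eqP <-] /existsP[j /eqP <-].
by move=> /orderE /xw[].
Qed.

Lemma E7_fanP C : groebner_fan (E7 R) C ->
  exists2 J : {set 'I_3}, J != finset.set0 &
  C = [set w | orthant R w /\ {in J, forall k, mcone k w}].
Proof.
move=> [x x0 <-]; exists [set k | `[< mcone k x >]]%SET.
  have [k xk] := E7_min x0; apply/set0Pn; exists k.
  by rewrite inE; apply/asboolP.
rewrite E7_coneE//; apply/seteqP; split => w [w0 xw]; split=> // k.
  by rewrite inE => /asboolP; exact: xw.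
by move=> xk; apply: xw; rewrite inE; apply/asboolP.
Qed.

Lemma E7_cone_sub C : groebner_fan (E7 R) C -> exists k, C `<=` mcone k.
Proof.
move=> /E7_fanP[J /set0Pn[k kJ] ->]; exists k => w [_]; exact.
Qed.

(** A vector in the interior of each maximal cone, completed to a basis of the
    lattice by two vectors of the cone. *)
Definition mcone_basis k : 3.-tuple tri :=
  nth [tuple (0, 0, 0) | i < 3]
  [:: [tuple (1, 1, 1); (0, 1, 0); (0, 0, 1)];
      [tuple (2, 1, 1); (1, 0, 0); (0, 0, 1)];
      [tuple (3, 2, 1); (1, 0, 0); (1, 1, 0)]] k.

Definition tri_wt (t : tri) k : int :=
  [:: 2 * t.1.1; 3 * t.1.2; t.1.2 + 3 * t.2]`_k.

Lemma wt_vec t k : wt (vec t) k = tri_wt t k.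
Proof. by move: k; apply: ord3P; rewrite wt_mon !mxE. Qed.

Definition tri_cone k (t : tri) :=
  [&& 0 <= t.1.1, 0 <= t.1.2, 0 <= t.2, tri_wt t k <= tri_wt t 0,
      tri_wt t k <= tri_wt t 1 & tri_wt t k <= tri_wt t 2].

Lemma mcone_vec k t : mcone k (realv R (vec t)) <-> tri_cone k t.
Proof.
split=> [[t0 tk]|/and5P[t0 t1 t2 k0 /andP[k1 k2]]].
  have := (t0 0, t0 1, t0 2, tk 0, tk 1, tk 2).
  rewrite !realvE !weight_realv !wt_vec !ler0z !ler_int !mxE.
  by move=> -[[[[[? ?] ?] ?] ?] ?]; apply/and5P; split=> //; apply/andP.
by split; apply: ord3P;
  rewrite ?realvE ?weight_realv ?wt_vec ?ler0z ?ler_int// mxE.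
Qed.

Lemma mcone_full k : full_dim (mcone k).
Proof.
exists (map_mx intr (gens (map_tuple vec (mcone_basis k)))).
  move=> i.
  have -> : row i (map_mx intr (gens (map_tuple vec (mcone_basis k)))) =
      realv R (vec (tnth (mcone_basis k) i)).
    by apply/rowP => j; rewrite !mxE tnth_map mxE.
  apply/mcone_vec; move: k; apply: ord3P; move: i; apply: ord3P; by [].
rewrite row_free_unit unitmxE det_map_mx rmorph_unit// -unitmxE.
apply: gens_unitmx.
by move: k; apply: ord3P.
Qed.

(** The first vector of the basis is interior. *)
Lemma mcone_groebner k : groebner_fan (E7 R) (mcone k).
Proof.
have k0 : orthant R (realv R (vec (tnth (mcone_basis k) 0))).
  suff /mcone_vec[] : tri_cone k (tnth (mcone_basis k) 0) by [].
  by move: k; apply: ord3P.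
exists (realv R (vec (tnth (mcone_basis k) 0))) => //.
rewrite E7_coneE//; apply/seteqP; split=> w.
  move=> [_]; apply; apply/mcone_vec; by move: k {k0}; apply: ord3P.
move=> wk; split=> [|j /mcone_vec jk]; first by case: wk.
suff -> : j = k by [].
by move: k j jk {k0 wk}; apply: ord3P; apply: ord3P.
Qed.

(** A cone on which two terms are minimal lies in the plane where they are
    equal. *)
Lemma E7_full_dim C : groebner_fan (E7 R) C -> full_dim C ->
  exists k, C = mcone k.
Proof.
move=> /E7_fanP[J /set0Pn[k kJ] ->] [M MC free]; exists k.
apply/seteqP; split=> w; first by move=> [_]; exact.
move=> wk; split=> [|j jJ]; first by case: wk.
have [<-//|kj] := eqVneq k j.
pose l : 'cV[R]_3 := \col_i ((mon k i)%:R - (mon j i)%:R).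
have lE x : (x *m l) 0 0 = weight x (mon k) - weight x (mon j).
  by rewrite mxE -sumrB; apply: eq_bigr => i _; rewrite mxE mulrBr.
have : M *m l = 0.
  apply/matrixP => i z; rewrite ord1.
  have -> : (M *m l) i 0 = (row i M *m l) 0 0 by rewrite -row_mul [RHS]mxE.
  have [_ Mi] := MC i; have [_ k_j] := Mi k kJ; have [_ j_k] := Mi j jJ.
  by rewrite lE mxE; apply/eqP; rewrite subr_eq0 eq_le k_j j_k.
rewrite row_free_unit in free => Ml0.
have /colP l0 : l = 0 by rewrite -(mulKmx free l) Ml0 mulmx0.
have monE i : mon k i = mon j i.
  apply/eqP; have := l0 i; rewrite !mxE => /eqP.
  by rewrite subr_eq0 eqr_nat.
case/eqP: kj; move: (monE 0) (monE 1) (monE 2); clear.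
by move: k j; apply: ord3P; apply: ord3P; rewrite /mon /= !mnmE.
Qed.

(** A Groebner cone with only one minimal term is maximal, hence not in the
    skeleton. *)
Lemma skeleton_E7 x : skeleton (E7 R) x ->
  exists k j, [/\ k != j, mcone k x & mcone j x].
Proof.
move=> [C [CG Cnf] Cx]; have [J J0 CE] := E7_fanP CG.
have [x0 Jx] : orthant R x /\ {in J, forall k, mcone k x} by rewrite CE in Cx.
have [k kJ] := set0Pn _ J0.
have [Jk|] := eqVneq J [set k]%SET.
  case: Cnf; have -> : C = mcone k; last exact: mcone_full.
  rewrite CE Jk; apply/seteqP; split=> w.
    by move=> [_ /(_ k)]; apply; rewrite inE.
  by move=> wk; split=> [|j]; [case: wk|rewrite inE => /eqP ->].
rewrite finset.eqEsubset finset.sub1set kJ andbT => /subsetPn[j jJ].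
rewrite inE => jk; exists j, k; split=> //; exact: Jx.
Qed.

End GroebnerFanE7.
Arguments mcone : clear implicits.

Section Profiles.
Variable R : realType.
Implicit Types (x : 'rV[R]_3) (v : lattice) (k : 'I_3).

(** By induction: the tail of the combination is rescaled to have sum 1. *)
Lemma convex_set_sum (A : set 'rV[R]_3) (s : seq lattice) (c : lattice -> R) :
  @convex_set R 'rV[R]_3 A -> (forall v, 0 <= c v) -> \sum_(v <- s) c v = 1 ->
  {in s, forall v, A (realv R v)} -> A (\sum_(v <- s) c v *: realv R v).
Proof.
move=> convA; elim: s c => [|v s IH] c c0.
  by rewrite big_nil => /esym/eqP; rewrite oner_eq0.
rewrite !big_cons => cs As.
have Av : A (realv R v) by apply: As; exact: mem_head.
have s0 : 0 <= \sum_(u <- s) c u by apply: sumr_ge0.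
have [sE|sN] := eqVneq (\sum_(u <- s) c u) 0.
  rewrite big_seq big1 ?addr0 => [|u us].
    by have -> : c v = 1; [lra|rewrite scale1r].
  move/eqP: sE; rewrite psumr_eq0// => /allP/(_ _ us) /eqP ->.
  by rewrite scale0r.
set a := \sum_(u <- s) c u in cs s0 sN *.
have p0 : 0 <= c v by [].
have p1 : c v <= 1 by rewrite -cs lerDl.
have := convA (realv R v) (\sum_(u <- s) (c u / a) *: realv R u) (Itv01 p0 p1).
rewrite !inE => /(_ Av) H.
have : A (\sum_(u <- s) (c u / a) *: realv R u).
  apply: IH => [u||u us]; first by rewrite divr_ge0.
    by rewrite -mulr_suml divff.
  by apply: As; rewrite inE us orbT.
move=> /H; congr A; rewrite /conv/=; congr (_ + _).
rewrite scaler_sumr; apply: eq_bigr => u _; rewrite scalerA; congr (_ *: _).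
rewrite -[LHS]/((1 - c v) * (c u / a)).
have -> : 1 - c v = a by rewrite -cs addrC addKr.
by rewrite mulrCA divff ?mulr1.
Qed.

Definition mcone_gens k : seq tri :=
  nth [::] [:: [:: (0, 1, 0); (0, 0, 1); (1, 2, 0); (9, 6, 4)];
               [:: (1, 0, 0); (0, 0, 1); (9, 6, 4)];
               [:: (1, 0, 0); (1, 2, 0); (9, 6, 4)]] k.

Lemma mcone_sub (s : seq lattice) k : {in s, forall v, mcone R k (realv R v)} ->
  gcone R s `<=` mcone R k.
Proof.
move=> sk x sx; split.
  apply: gcone_orthant sx => v vs i; have [v0 _] := sk v vs.
  by rewrite -(ler0z R) -realvE.
move=> j; have [c c0 ->] := sx.
have sumE m : weight (\sum_(v <- s) c v *: realv R v) m =
    \sum_(v <- s) c v * weight (realv R v) m.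
  elim: (s) => [|v r IH]; last by rewrite !big_cons weightD weightZ IH.
  by rewrite !big_nil /weight big1// => i _; rewrite mxE mul0r.
rewrite !sumE big_seq [leRHS]big_seq ler_sum// => v vs.
by rewrite ler_wpM2l//; have [_] := sk v vs.
Qed.

Lemma mcone_gens_uniq k : uniq [seq vec t | t <- mcone_gens k].
Proof.
rewrite map_inj_uniq; last exact: vec_inj.
by move: k; apply: ord3P.
Qed.

Lemma mcone_gcone k : mcone R k = gcone R [seq vec t | t <- mcone_gens k].
Proof.
apply/seteqP; split; last first.
  apply: mcone_sub => _ /mapP[t tk ->]; apply/mcone_vec.
  have chk : all (tri_cone k) (mcone_gens k) by move: k {tk}; apply: ord3P.
  exact: (allP chk).
have gen t : t \in mcone_gens k -> forall c, 0 <= c ->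
    gcone R [seq vec t | t <- mcone_gens k] (c *: realv R (vec t)).
  move=> tk c c0; apply: gconeZ => //; apply: gcone_gen; last exact: map_f.
  exact: mcone_gens_uniq.
move=> x [x0 xk]; have := (x0 0, x0 1, x0 2, xk 0, xk 1, xk 2).
rewrite !weight_mon; move: k gen {x0 xk}; apply: ord3P => gen;
  rewrite ?weight_mon => -[[[[[a0 b0] c0] k0] k1] k2].
(* The plane 4a = 9c through the generators (0, 1, 0) and (9, 6, 4) cuts the
   cone with four generators into two simplicial ones. *)
- have [ac|ca] := leP (4 * x 0 0) (9 * x 0 2).
    have -> : x = (x 0 1 - x 0 0 * 2 / 3) *: realv R (vec (0, 1, 0)) +
        (x 0 2 - x 0 0 * 4 / 9) *: realv R (vec (0, 0, 1)) +
        (x 0 0 / 9) *: realv R (vec (9, 6, 4)).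
      by apply: row3P; rewrite !mxE /=; field.
    by apply: gconeD; [apply: gconeD|]; apply: gen => //; lra.
  have -> : x = (x 0 1 - 2 * x 0 0 + 3 * x 0 2) *: realv R (vec (0, 1, 0)) +
        (x 0 0 - x 0 2 * 9 / 4) *: realv R (vec (1, 2, 0)) +
        (x 0 2 / 4) *: realv R (vec (9, 6, 4)).
    by apply: row3P; rewrite !mxE /=; field.
  by apply: gconeD; [apply: gconeD|]; apply: gen => //; lra.
- have -> : x = (x 0 0 - x 0 1 * 3 / 2) *: realv R (vec (1, 0, 0)) +
        (x 0 2 - x 0 1 * 2 / 3) *: realv R (vec (0, 0, 1)) +
        (x 0 1 / 6) *: realv R (vec (9, 6, 4)).
    by apply: row3P; rewrite !mxE /=; field.
  by apply: gconeD; [apply: gconeD|]; apply: gen => //; lra.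
have -> : x = (x 0 0 - x 0 1 / 2 - x 0 2 * 3 / 2) *: realv R (vec (1, 0, 0)) +
        (x 0 1 / 2 - x 0 2 * 3 / 4) *: realv R (vec (1, 2, 0)) +
        (x 0 2 / 4) *: realv R (vec (9, 6, 4)).
  by apply: row3P; rewrite !mxE /=; field.
by apply: gconeD; [apply: gconeD|]; apply: gen => //; lra.
Qed.

Lemma points_primitive t : t \in E7_points -> primitive (vec t).
Proof.
move=> tE; have [p ptab tp] : exists2 p, p \in E7_table & vec t \in p.1.
  by apply/E7_points_table; exists t.
exact: (unimodular_primitive R (E7_table_uniq ptab) (E7_table_unimodular ptab)).
Qed.

(** Certificates that the generators of the maximal cones are extremal: each
    form is positive on all generators but one, where it vanishes. *)
Definition supporting_forms k : seq tri :=
  nth [::] [:: [:: (1, 0, 1); (-1, 3, 0); (-2, 1, 4); (-4, 4, 3)];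
               [:: (0, -1, 3); (2, -2, 0); (2, -5, 3)];
               [:: (0, 2, -2); (2, -1, -2); (2, 1, -6)]] k.

Lemma extremal_mcone k v :
  extremal (mcone R k) v <-> v \in [seq vec t | t <- mcone_gens k].
Proof.
have prim : {in [seq vec t | t <- mcone_gens k], forall u, primitive u}.
  move=> _ /mapP[t tk ->]; apply: points_primitive.
  have chk : all (fun t => t \in E7_points) (mcone_gens k).
    by move: k {tk}; apply: ord3P; vm_compute.
  exact: (allP chk).
rewrite mcone_gcone; split.
  exact: extremal_gcone (mcone_gens_uniq k) prim.
move=> vk; split; first exact: prim.
move: vk => /mapP[t tk ->].
have chk : all (fun t => has (fun h => all (fun u => 
    (0 <= dot u h) && ((dot u h == 0) == (u == t))) (mcone_gens k))
    (supporting_forms k)) (mcone_gens k).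
  by move: k {tk prim}; apply: ord3P; vm_compute.
have /hasP[h _ /allP hP] := allP chk t tk.
exists (map_mx intr (form h)) => [x|].
  apply: gcone_form_ge0 => _ /mapP[u uk ->].
  by rewrite form_realv vec_form ler0z; have /andP[] := hP u uk.
rewrite gcone_zero => [|_ /mapP[u uk ->]]; last first.
  by rewrite form_realv vec_form ler0z; have /andP[] := hP u uk.
rewrite ray_gcone; congr gcone; rewrite filter_map.
rewrite (eq_in_filter (a2 := pred1 t)) => [|u uk]; last first.
  rewrite /= form_realv vec_form intr_eq0.
  by have /andP[_ /eqP] := hP u uk.
rewrite filter_pred1_uniq//; have := mcone_gens_uniq k.
by rewrite map_inj_uniq//; exact: vec_inj.
Qed.

(** The boundaries of the profiles are the planes where these forms take the
    value 1. *)
Definition level k : tri :=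
  nth (0, 0, 0) [:: (-1, 1, 1); (1, -2, 1); (1, 0, -2)] k.

(** As the generators have level 1, the points of level 1 of the cone are the
    combinations of the generators with coefficients of sum 1. *)
Lemma profile_mcone k : profile (mcone R k) =
  [set x | mcone R k x /\ (x *m map_mx intr (form (level k))) 0 0 = 1].
Proof.
have lev t : t \in mcone_gens k -> dot t (level k) = 1.
  have chk : all (fun t => dot t (level k) == 1) (mcone_gens k).
    by move: k; apply: ord3P.
  by move=> /(allP chk) /eqP.
apply/seteqP; split=> [|x [xk xl]].
  apply: smallest_sub => [x y p|_ [v /extremal_mcone vk <-]].
    rewrite !inE => -[xk xl] [yk yl].
    have p0 : 0 <= p%:num by [].
    have p1 : 0 <= 1 - p%:num by [].
    rewrite /conv /=; split.
      move: xk yk; rewrite mcone_gcone => xk yk.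
      by apply: gconeD; exact: gconeZ.
    rewrite mulmxDl -!scalemxAl [LHS]mxE [X in X + _]mxE [X in _ + X]mxE.
    rewrite xl yl !mulr1; exact: subrKC.
  split.
    by rewrite mcone_gcone; apply: gcone_gen => //; exact: mcone_gens_uniq.
  by move: vk => /mapP[t tk ->]; rewrite form_realv vec_form lev.
move=> A [convA gensA]; move: xk xl; rewrite mcone_gcone => -[c c0 ->].
rewrite mulmx_suml summxE => xl; apply: convex_set_sum => //.
  rewrite -[RHS]xl big_seq [RHS]big_seq; apply: eq_bigr => _ /mapP[t tk ->].
  by rewrite -scalemxAl mxE form_realv vec_form lev// mulr1.
by move=> v vk; apply: gensA; exists v => //; apply/extremal_mcone.
Qed.

Lemma profile_pointsE : profile_points (E7 R) =
  [set v | exists k, mcone R k (realv R v) /\ (v *m form (level k)) 0 0 = 1].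
Proof.
have E k v : profile (mcone R k) (realv R v) <->
    mcone R k (realv R v) /\ (v *m form (level k)) 0 0 = 1.
  rewrite profile_mcone /= form_realv.
  split=> -[vk /eqP vl]; split=> //; apply/eqP; move: vl;
  by rewrite (eqr_int _ _ 1).
apply/seteqP; split=> v.
  by move=> [C [CG /(E7_full_dim CG)[k ->] /E]]; exists k.
move=> [k /E vk]; exists (mcone R k); split=> //.
  exact: mcone_groebner.
exact: mcone_full.
Qed.

End Profiles.

(** * Existence of the refinement *)

Section Existence.
Variable R : realType.

Lemma ord3_has (P : pred 'I_3) : has P [:: 0; 1; 2] -> exists k, P k.
Proof. by move=> /hasP[k _ Pk]; exists k. Qed.

(** The bounds are the largest coordinates of the vertices of the profiles. *)
Lemma level_points k t : tri_cone k t -> dot t (level k) = 1 -> t \in E7_points.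
Proof.
case: t => -[a b] c tk tl.
have [ab bb cb] : [/\ 0 <= a < 10, 0 <= b < 7 & 0 <= c < 5].
  move: k tk tl; apply: ord3P; rewrite /tri_cone /tri_wt /dot /level /=;
  by move=> /and5P[? ? ? ? /andP[? ?]] ?; split; lia.
have [n nE] : exists n : nat, a = n by exists `|a|%N; lia.
have [m mE] : exists n : nat, b = n by exists `|b|%N; lia.
have [p pE] : exists n : nat, c = n by exists `|c|%N; lia.
subst a b c.
have chk : all (fun n => all (fun m => all (fun p : nat =>
    let t := (Posz n, Posz m, Posz p) in
    tri_cone k t && (dot t (level k) == 1) ==> (t \in E7_points))
    (iota 0 5)) (iota 0 7)) (iota 0 10).
  by move: k {tk tl}; apply: ord3P; vm_compute.
have nI : n \in iota 0 10 by rewrite mem_iota; lia.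
have mI : m \in iota 0 7 by rewrite mem_iota; lia.
have pI : p \in iota 0 5 by rewrite mem_iota; lia.
have /implyP := allP (allP (allP chk n nI) m mI) p pI; apply.
by rewrite tk tl eqxx.
Qed.

Lemma profile_points_E7 : profile_points (E7 R) =
  [set v | exists2 t, t \in E7_points & v = vec t].
Proof.
rewrite profile_pointsE; apply/seteqP; split=> v.
  move=> [k]; rewrite (vec_surj v); set t := (_, _, _) => -[/mcone_vec tk].
  by rewrite vec_form => tl; exists t => //; exact: level_points tk tl.
move=> [t tE ->].
have chk : all (fun t => has (fun k => tri_cone k t && (dot t (level k) == 1))
  [:: 0; 1; 2]) E7_points by vm_compute.
have /ord3_has[k /andP[tk /eqP tl]] := allP chk t tE.
by exists k; rewrite vec_form; split=> //; apply/mcone_vec.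
Qed.

Lemma E7_table_fan_rays : rays (table_fan R E7_table) = profile_points (E7 R).
Proof.
rewrite table_fan_rays; [|exact: E7_table_uniq|exact: E7_table_unimodular].
by rewrite profile_points_E7; apply/seteqP; split=> v /E7_points_table.
Qed.

Lemma E7_table_fan_refines :
  regular_refinement (table_fan R E7_table) (groebner_fan (E7 R)).
Proof.
split.
- apply: table_fan_fan.
  + exact: E7_table_uniq.
  + exact: E7_table_unimodular.
  + exact: E7_table_ge0.
  + exact: E7_table_convex.
- apply: table_fan_regular.
  + exact: E7_table_uniq.
  + exact: E7_table_unimodular.
- move=> _ [p [s [/mapP[T TE ->] sp ->]]].
  have chk : all (fun p : 3.-tuple tri * tri =>
    has (fun k => all (tri_cone k) (p.1 : seq tri)) [:: 0; 1; 2]) E7_triangles.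
    by vm_compute.
  have /ord3_has[k /allP kP] := allP chk T TE.
  exists (mcone R k); first exact: mcone_groebner.
  apply: mcone_sub => v /(mem_subseq sp) /mapP[t tT ->].
  by apply/mcone_vec; exact: kP.
rewrite groebner_cover.
apply: table_fan_cover => //.
- exact: E7_table_uniq.
- exact: E7_table_unimodular.
- exact: E7_table_ge0.
- exact: E7_table_convex.
- exact: E7_table_closed.
Qed.

End Existence.

(** * Charts *)

Section Charts.
Variable R : realType.
Implicit Types (Sigma : set (set 'rV[R]_3)) (v : 3.-tuple lattice).

(** The rays of a chart are faces of its cone, so the chart lists the extremal
    vectors of a regular cone, in some order. *)
Lemma chart_unitmx Sigma v : fan Sigma ->
  (forall C, Sigma C -> regular_cone C) -> chart Sigma v -> gens v \in unitmx.
Proof.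
move=> [_ _ _ _ meet] reg [uv rv].
rewrite cone_of_gcone// => Sv.
have prim : {in (v : seq _), forall w, primitive w} by move=> w /rv[].
have ext w : w \in (v : seq _) <-> extremal (gcone R v) w.
  split=> [wv|]; last exact: extremal_gcone.
  split; first exact: prim.
  have <- : gcone R v `&` ray R w = ray R w.
    apply/seteqP; split=> x; first by case.
    move=> xw; split=> //; move: xw; rewrite ray_gcone.
    apply: gcone_sub => // u; by rewrite inE => /eqP ->.
  by apply: meet => //; have [] := rv w wv.
have [k [s [us sE /= gcdM]]] := reg _ Sv.
have sv : perm_eq s v.
  by apply: uniq_perm => // w; apply/idP/idP => [/sE/ext|/ext/sE].
have k3 : k = 3%N by rewrite -(size_tuple s) (perm_size sv) size_tuple.
subst k; have [sigma sE'] := tuple_permP sv.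
set M := \matrix_(i, j) _ in gcdM.
have ME : M = (perm_mx sigma *m gens v)^T.
  apply/matrixP => i j; rewrite -row_permE !mxE; congr (_ 0 i).
  by rewrite (tnth_nth 0) sE' -tnth_nth tnth_mktuple.
have : (\det M %| (1 : int)%R)%Z.
  rewrite -gcdM; apply: (big_rec (fun d => (\det M %| d)%Z)) => // g d _ Md.
  rewrite dvdz_gcd Md andbT.
  have -> : rowsub g M = rowsub g 1%:M *m M by rewrite mul_rowsub_mx mul1mx.
  by rewrite det_mulmx dvdz_mull.
rewrite dvdz1 ME det_tr det_mulmx abszM muln_eq1 => /andP[_ /eqP d1].
rewrite unitmxE; change ((\det (gens v) == 1) || (\det (gens v) == -1)).
by move: d1; case: (\det (gens v)) => [n /= ->|[|n]].
Qed.

Lemma chart_ge0 Sigma v : \bigcup_(C in Sigma) C `<=` orthant R ->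
  chart Sigma v -> forall i j, 0 <= tnth v i 0 j.
Proof.
move=> Sigma0 [uv rv Sv] i j; rewrite -(ler0z R) -realvE; apply: Sigma0.
exists (cone_of R v) => //; rewrite cone_of_gcone//.
by apply: gcone_gen => //; exact: mem_tnth.
Qed.

(** * Monomial maps of the torus *)

Definition torus_map (A : 'M[int]_3) (u : 'I_3 -> R[i]) : 'I_3 -> R[i] :=
  fun j => \prod_i u i ^ A i j.

Lemma torus_mapP A u : torus R u -> torus R (torus_map A u).
Proof.
by move=> u0 j; apply/prodf_neq0 => i _; rewrite expfz_neq0.
Qed.

Lemma torus_map_comp A B u : torus R u ->
  torus_map A (torus_map B u) = torus_map (B *m A) u.
Proof.
move=> u0; apply/funext => j; rewrite /torus_map.
have exp_prod (F : 'I_3 -> R[i]) n : (\prod_i F i) ^ n = \prod_i F i ^ n.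
  by apply: (big_morph (fun x => x ^ n)) => [x y|]; rewrite ?expfzMl// exp1rz.
have exp_sum (x : R[i]) (F : 'I_3 -> int) : x != 0 ->
      x ^ (\sum_i F i) = \prod_i x ^ F i.
  by move=> x0; apply: (big_morph (fun n => x ^ n)) => // m n; rewrite expfzDr.
under eq_bigr do rewrite exp_prod.
rewrite exchange_big; apply: eq_bigr => i _; rewrite mxE exp_sum//.
by apply: eq_bigr => k _; rewrite exprz_exp.
Qed.

Lemma torus_map1 u : torus_map 1%:M u = u.
Proof.
apply/funext => j; rewrite /torus_map (bigD1 j)//= mxE eqxx expr1z.
rewrite big1 ?mulr1//.
by move=> i /negPf ij; rewrite mxE ij expr0z.
Qed.

Lemma torus_map_bij A : A \in unitmx ->
  set_bij (torus R) (torus R) (torus_map A).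
Proof.
move=> uA; split.
- by move=> u; exact: torus_mapP.
- move=> u w; rewrite !inE => u0 w0 /(congr1 (torus_map (invmx A))).
  by rewrite !torus_map_comp// mulmxV// !torus_map1.
- move=> u u0; exists (torus_map (invmx A) u); first exact: torus_mapP.
  by rewrite torus_map_comp// mulVmx// torus_map1.
Qed.

Lemma chart_mapE v u : (forall i j, 0 <= tnth v i 0 j) ->
  chart_map v u = torus_map (gens v) u.
Proof.
move=> v0; apply/funext => j; rewrite /chart_map /chart_monomial mevalX.
by apply: eq_bigr => i _; rewrite mnmE mxE -{2}(gez0_abs (v0 i j)).
Qed.

End Charts.

(** * Normal crossings *)

Section NormalCrossings.
Variable R : realType.
Implicit Types (v : 3.-tuple lattice) (p : 'I_3 -> R[i]).

Definition chart_exponent v k : 'X_{1..3} :=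
  [multinom `|wt (tnth v i) k|%N | i < 3].

Lemma total_transform_mon v k : (forall i j, 0 <= tnth v i 0 j) ->
  total_transform ('X_[mon k] : {mpoly R[i][3]}) v = 'X_[chart_exponent v k].
Proof.
move=> v0; rewrite /total_transform comp_mpolyX.
under eq_bigr do rewrite tnth_mktuple /chart_monomial mpolyXn.
rewrite -(big_morph (fun m : 'X_{1..3} => 'X_[m] : {mpoly R[i][3]})
  (mpolyXD _) (mpolyX0 _ _)).
congr 'X_[_]; apply/mnmP => i; rewrite mnm_sumE !mnmE.
apply/eqP; rewrite -eqz_nat gez0_abs; last first.
  by rewrite /wt sumr_ge0// => j _; rewrite mulr_ge0.
rewrite /wt (big_morph Posz PoszD (erefl _)); apply/eqP/eq_bigr => j _.
by rewrite mulmnE mnmE PoszM gez0_abs.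
Qed.

(** Euler's formula for a monomial. *)
Lemma mderivX_meval p m j :
  p j * (('X_[m] : {mpoly R[i][3]})^`M(j)).@[p] = (m j)%:R * 'X_[m].@[p].
Proof.
rewrite mderivX mevalZ mulrCA; have [->|mj] := eqVneq (m j) 0%N.
  by rewrite !mul0r.
have -> : 'X_[m] = 'X_[m - U_(j)] * 'X_j :> {mpoly R[i][3]}.
  by rewrite -mpolyXD submK// lep1mP.
by rewrite mevalM mevalXU [p j * _]mulrC.
Qed.

(** The constant term of h puts the exponent a in the support of the total
    transform, so the monomial of exponent m divides that of exponent a. The
    quotient divides g, hence it is 1. *)
Lemma strict_transform_uniq v m g a (h : {mpoly R[i][3]}) :
  total_transform (E7 R) v = 'X_[a] * h -> h@_0%MM != 0 ->
  strict_transform (E7 R) v m g -> g = h.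
Proof.
move=> Ta h0 [Tm g_prime].
have : a \in msupp ('X_[m] * g).
  by rewrite -Tm Ta mcoeff_msupp [_ * h]mulrC -[X in mcoeff X]addm0 mcoeffMX.
rewrite mulrC (perm_mem (msuppMX _ _)) => /mapP[b _ ab].
have gE : g = 'X_[b] * h.
  have Xm : ('X_[m] : {mpoly R[i][3]}) != 0 by rewrite -msupp_eq0 msuppX.
  by apply: (mulfI Xm); rewrite -Tm Ta ab mpolyXD mulrA.
have [b0|[i bi]] : b = 0%MM \/ exists i, b i != 0%N.
  case: (boolP [exists i, b i != 0%N]) => [/existsP[i bi]|].
    by right; exists i.
  rewrite negb_exists => /forallP b0; left; apply/mnmP => i.
  by rewrite mnm0E; apply/eqP; have := b0 i; rewrite negbK.
  by rewrite gE b0 mpolyX0 mul1r.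
case: (g_prime i ('X_[b - U_(i)] * h)).
by rewrite mulrA -mpolyXD addmC submK ?lep1mP.
Qed.

(** The strict transform is a sum of three monomials, one of them equal to 1. If
    a linear relation between the differentials at p involved that of the strict
    transform, then by Euler's formula the values of the three monomials at p
    would solve three linear equations. These are obtained by the chart matrix,
    which is invertible, from the equations that the logarithmic derivatives of
    f vanish. As the exponents of f are linearly independent, the three values
    would be zero, which is not the case of the monomial 1. *)
Lemma snc_chart v k : gens v \in unitmx -> (forall i j, 0 <= tnth v i 0 j) ->
  (forall i j, wt (tnth v i) k <= wt (tnth v i) j) ->
  snc_total_transform (E7 R) v.
Proof.
move=> uv v0 vk m g gT.
pose al j := (chart_exponent v j - chart_exponent v k)%MM.
have wt0 i j : 0 <= wt (tnth v i) j.
  by rewrite /wt sumr_ge0// => l _; rewrite mulr_ge0.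
have alE j i : (al j i : int) = wt (tnth v i) j - wt (tnth v i) k.
  rewrite mnmBE !mnmE; have := vk i j; have := wt0 i k; lia.
have TE : total_transform (E7 R) v = 'X_[chart_exponent v k] * \sum_j 'X_[al j].
  rewrite E7E /total_transform !comp_mpolyD -!/(total_transform _ _).
  rewrite !total_transform_mon// sum3 !mulrDr -!mpolyXD.
  have le j : (chart_exponent v k <= chart_exponent v j)%MM.
    apply/mnm_lepP => i; rewrite !mnmE; have := vk i j; have := wt0 i k; lia.
  by congr (_ + _ + _); congr 'X_[_]; rewrite addmC submK.
have alk : al k = 0%MM by apply/mnmP => i; rewrite mnmBE subnn mnm0E.
have {gT}-> : g = \sum_j 'X_[al j].
  apply: (strict_transform_uniq TE) gT.
  rewrite raddf_sum /= (bigD1 k)//= alk mcoeffX eqxx.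
  under eq_bigr do rewrite mcoeffX.
  by rewrite -natr_sum -natrD pnatr_eq0.
move=> p; rewrite raddf_sum /= => gp c d d0 rel.
pose P j := ('X_[al j] : {mpoly R[i][3]}).@[p].
suff c0 : c = 0.
  by split=> // i; have := rel i; rewrite c0 mul0r add0r.
apply/eqP/negP => /negP c0.
have eulerE i : \sum_j (al j i)%:R * P j = 0.
  under eq_bigr do rewrite -mderivX_meval.
  rewrite -mulr_sumr; have [->|pi] := eqVneq (p i) 0; first by rewrite mul0r.
  have := rel i; rewrite d0; last by rewrite (negPf pi) andbF.
  rewrite addr0 => /eqP; rewrite mulf_eq0 (negPf c0)/=.
  rewrite (raddf_sum (mderiv i)) (raddf_sum (meval p)) /= => /eqP ->.
  by rewrite mulr0.
pose y : 'cV[R[i]]_3 := \col_l \sum_j (mon j l)%:R * P j.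
have : map_mx intr (gens v) *m y = 0.
  apply/matrixP => i z; rewrite !mxE.
  have -> : \sum_l map_mx intr (gens v) i l * y l z =
      \sum_j (wt (tnth v i) j)%:~R * P j.
    under eq_bigr do rewrite !mxE mulr_sumr.
    rewrite exchange_big; apply: eq_bigr => j _.
    rewrite /wt rmorph_sum mulr_suml; apply: eq_bigr => l _.
    by rewrite rmorphM mulrA.
  have -> : \sum_j (wt (tnth v i) j)%:~R * P j =
      \sum_j (al j i)%:R * P j + (wt (tnth v i) k)%:~R * \sum_j P j.
    rewrite mulr_sumr -big_split; apply: eq_bigr => j _.
    by rewrite /= -mulrDl -[(al j i)%:R]/((al j i : int)%:~R) alE intrB subrK.
  by rewrite eulerE gp mulr0 addr0.
have uvC : map_mx (intr : int -> R[i]) (gens v) \in unitmx.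
  by rewrite unitmxE det_map_mx rmorph_unit// -unitmxE.
move=> y0; have /colP {}y0 : y = 0 by rewrite -(mulKmx uvC y) y0 mulmx0.
have Pk : P k = 1 by rewrite /P alk mpolyX0 meval1.
have : forall j, P j = 0.
  move: (y0 0) (y0 1) (y0 2).
  rewrite !mxE !sum3 /mon /= !mnmE /= !mul0r ?add0r ?addr0.
  move=> /eqP; rewrite mulf_eq0 pnatr_eq0 /= => /eqP P0 P12 /eqP.
  rewrite mulf_eq0 pnatr_eq0 /= => /eqP P2; move: P12; rewrite P2 mulr0 addr0.
  by move=> /eqP; rewrite mulf_eq0 pnatr_eq0 /= => /eqP P1; apply: ord3P.
by move=> /(_ k); rewrite Pk => /eqP; rewrite oner_eq0.
Qed.

End NormalCrossings.

Section Resolution.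
Variable R : realType.

Lemma resolution (Sigma : set (set 'rV[R]_3)) :
  regular_refinement Sigma (groebner_fan (E7 R)) ->
  embedded_toric_resolution (E7 R) Sigma.
Proof.
move=> [fanS regS subS]; rewrite groebner_cover => coverS.
have orthS : \bigcup_(C in Sigma) C `<=` orthant R by rewrite coverS.
split=> // v vS; have uv := chart_unitmx fanS regS vS;
  have v0 := chart_ge0 orthS vS.
  have -> : chart_map v = torus_map (gens v) :> (('I_3 -> R[i]) -> _).
    by apply/funext => u; exact: chart_mapE.
  exact: torus_map_bij.
have [uniqv _ Sv] := vS; have [D DG vD] := subS _ Sv.
have [k Dk] := E7_cone_sub DG.
apply: (snc_chart (k := k) uv v0) => i j.
have [_ /(_ j)] : mcone R k (realv R (tnth v i)).
  apply/Dk/vD; rewrite cone_of_gcone//.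
  by apply: gcone_gen => //; exact: mem_tnth.
by rewrite !weight_realv ler_int.
Qed.

End Resolution.

(** * Minimality *)

Section Minimality.
Variable R : realType.
Implicit Types (Sigma : set (set 'rV[R]_3)) (v : lattice) (t s : tri).

(** The levels of two maximal cones differ by a multiple of the equation of
    their common face. *)
Lemma level_agree k j t : tri_cone k t -> tri_cone j t ->
  dot t (level k) = dot t (level j).
Proof.
case: t => -[a b] c; move: k j; apply: ord3P; apply: ord3P;
  rewrite /tri_cone /tri_wt /dot /level /=;
  by move=> /and5P[? ? ? ? /andP[? ?]] /and5P[? ? ? ? /andP[? ?]]; lia.
Qed.

Lemma level_ge0 k t : tri_cone k t -> 0 <= dot t (level k).
Proof.
case: t => -[a b] c; move: k; apply: ord3P;
  rewrite /tri_cone /tri_wt /dot /level /=;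
  by move=> /and5P[? ? ? ? /andP[? ?]]; lia.
Qed.

Lemma level_eq0 k t : tri_cone k t -> dot t (level k) = 0 -> vec t = 0.
Proof.
move=> tk tl; have -> : t = (0, 0, 0).
  case: t tk tl => -[a b] c; move: k; apply: ord3P;
  rewrite /tri_cone /tri_wt /dot /level /=;
  by move=> /and5P[? ? ? ? /andP[? ?]] ?; congr (_, _, _); lia.
by apply: (@row3P int); rewrite !mxE.
Qed.

(** If two vectors of a maximal cone have a sum of level 1, then one of them has
    level 0, so it vanishes. *)
Lemma irreducible_profile C v : groebner_fan (E7 R) C ->
  profile_points (E7 R) v -> C (realv R v) -> irreducible_in C v.
Proof.
move=> CG vP Cv [u [w [Cu Cw uv wv vE]]].
have [k Ck] := E7_cone_sub CG.
have lev x : C (realv R x) -> exists2 t, x = vec t & tri_cone k t.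
  move=> /Ck; rewrite (vec_surj x); set t := (_, _, _) => /mcone_vec tk.
  by exists t.
have [t tE tk] := lev v Cv; have [a aE ak] := lev u Cu.
have [b bE bk] := lev w Cw.
have tl : dot t (level k) = 1.
  move: vP; rewrite profile_pointsE tE => -[j [/mcone_vec tj]].
  by rewrite vec_form (level_agree tk tj).
have abl : dot a (level k) + dot b (level k) = 1.
  by rewrite -tl -!vec_form -tE vE mulmxDl [RHS]mxE aE bE.
have := level_ge0 ak; have := level_ge0 bk => b0 a0.
have [al|bl] : dot a (level k) = 0 \/ dot b (level k) = 0 by lia.
  by case/eqP: wv; rewrite vE aE (level_eq0 ak al) add0r.
by case/eqP: uv; rewrite vE bE (level_eq0 bk bl) addr0.
Qed.

Definition tri_add s t : tri := (s.1.1 + t.1.1, s.1.2 + t.1.2, s.2 + t.2).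

Lemma vec_add s t : vec (tri_add s t) = vec s + vec t.
Proof. by apply: (@row3P int); rewrite !mxE. Qed.

Definition tri_skeleton t :=
  has (fun k => has (fun j => [&& k != j, tri_cone k t & tri_cone j t])
    [:: 0; 1; 2]) [:: 0; 1; 2].

Lemma skeleton_vec t : skeleton (E7 R) (realv R (vec t)) -> tri_skeleton t.
Proof.
have ordI : forall k : 'I_3, k \in [:: 0; 1; 2] by apply: ord3P.
move=> /skeleton_E7[k [j [kj /mcone_vec tk /mcone_vec tj]]].
apply/hasP; exists k => //; apply/hasP; exists j => //.
by rewrite kj tk tj.
Qed.

Definition skeleton_points := [seq t <- E7_points | tri_skeleton t].

(** The points of a segment of the skeleton are equidistant, and there are at
    most five of them: coefficients up to 4 are enough. *)
Definition tri_between u s t := has (fun n : nat => has (fun m : nat =>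
  iter n (tri_add u) (0, 0, 0) ==
  tri_add (iter m (tri_add s) (0, 0, 0)) (iter (n - m) (tri_add t) (0, 0, 0)))
  (iota 1 n)) (iota 1 4).

Lemma vec_iter n t : vec (iter n (tri_add t) (0, 0, 0)) = vec t *+ n.
Proof.
elim: n => [|n IH]; last by rewrite iterS vec_add IH mulrS.
by apply: (@row3P int); rewrite !mxE.
Qed.

Lemma realv_mulrn v n : realv R (v *+ n) = n%:R *: realv R v.
Proof. by rewrite /realv raddfMn scaler_nat. Qed.

Lemma between_gcone u s t : vec s != vec t -> tri_between u s t ->
  gcone R [:: vec s; vec t] (realv R (vec u)).
Proof.
move=> st /hasP[n + /hasP[m _ /eqP]]; rewrite mem_iota => /andP[n0 _].
move=> /(congr1 vec); rewrite vec_add !vec_iter => /(congr1 (realv R)).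
rewrite realvD !realv_mulrn => nE.
have nN : (n%:R : R) != 0 by rewrite pnatr_eq0 -lt0n.
have -> : realv R (vec u) = n%:R^-1 *:
    (m%:R *: realv R (vec s) + (n - m)%:R *: realv R (vec t)).
  by rewrite -nE scalerA mulVf// scale1r.
have uniq_st : uniq [:: vec s; vec t] by rewrite /= inE st.
apply: gconeZ; first by rewrite invr_ge0 ler0n.
apply: gconeD; apply: gconeZ; rewrite ?ler0n//; apply: gcone_gen => //.
  exact: mem_head.
by rewrite !inE eqxx orbT.
Qed.

(** The segment from t to an adjacent vector lies on the skeleton and contains
    no other vector, so that the vectors adjacent to t are among these ones. *)
Definition neighbours t := [seq s <- skeleton_points |
  [&& s != t, tri_skeleton (tri_add t s) &
      ~~ has (fun u => [&& u != t, u != s & tri_between u t s])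
             skeleton_points]].

Definition subset_sums (r : seq tri) : seq tri :=
  foldr (fun t sums => map (tri_add t) sums ++ sums) [:: (0, 0, 0)] r.

Lemma subset_sumsP (a : pred tri) (r : seq tri) :
  exists2 t, t \in subset_sums r & \sum_(s <- [seq s <- r | a s]) vec s = vec t.
Proof.
elim: r => [|s r [t tr IH]].
  exists (0, 0, 0); rewrite ?mem_head// big_nil.
  by apply: (@row3P int); rewrite !mxE.
rewrite /=; case: ifP => _; last by exists t; rewrite // mem_cat tr orbT.
exists (tri_add s t); first by rewrite mem_cat map_f.
by rewrite big_cons IH vec_add.
Qed.

Lemma not_subset_sum t : t \in skeleton_points ->
  t \notin subset_sums (neighbours t).
Proof.
have chk : all (fun t => t \notin subset_sums (neighbours t)) skeleton_points.
  by vm_compute.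
exact: (allP chk).
Qed.

Section Refinement.
Variable Sigma : set (set 'rV[R]_3).
Hypothesis fanS : fan Sigma.
Hypothesis raysS : rays Sigma = profile_points (E7 R).

Lemma vertices_vec v : vertices (E7 R) Sigma v ->
  exists2 t, t \in skeleton_points & v = vec t.
Proof.
move=> [vS vsk]; move: vS; rewrite raysS profile_points_E7 => -[t tE vt].
exists t => //; rewrite mem_filter tE andbT; apply: skeleton_vec.
by rewrite -vt.
Qed.

Lemma adjacent_neighbours t w : t \in skeleton_points ->
  adjacent (E7 R) Sigma (vec t) w ->
  exists2 s, s \in neighbours t & w = vec s.
Proof.
move=> tP [wt /vertices_vec[s sP ws] Sc sk]; subst w; exists s => //.
have st : s != t by apply: contraNN wt => /eqP ->.
have ts : vec t != vec s by rewrite eq_sym.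
have uniq_ts : uniq [tuple vec t; vec s] by rewrite /= inE ts.
rewrite cone_of_gcone// in Sc sk.
rewrite mem_filter; apply/andP; split=> //; apply/and3P; split=> //.
  apply/skeleton_vec/sk; rewrite vec_add realvD.
  apply: gconeD; apply: gcone_gen => //; by rewrite !inE eqxx ?orbT.
apply/hasPn => u uP; apply/negP => /and3P[ut us /(between_gcone ts) tsu].
have pP r : r \in skeleton_points -> r \in E7_points.
  by rewrite mem_filter => /andP[].
have uS : rays Sigma (vec u).
  by rewrite raysS profile_points_E7; exists u => //; exact: pP.
have [pu Su] := uS.
have ext : extremal (gcone R [:: vec t; vec s]) (vec u).
  split=> //.
  have <- : gcone R [:: vec t; vec s] `&` ray R (vec u) = ray R (vec u).
    apply/seteqP; split=> x; first by case.
    by move=> ux; split=> //; case: ux => a a0 ->; exact: gconeZ.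
  by case: fanS => _ _ _ _; apply.
have : vec u \in [:: vec t; vec s].
  apply: (extremal_gcone (R := R) uniq_ts _ ext) => r.
  rewrite !inE => /orP[] /eqP ->.
    exact/points_primitive/(pP _ tP).
  exact/points_primitive/(pP _ sP).
by rewrite !inE !(inj_eq vec_inj) (negPf ut) (negPf us).
Qed.

(** With self-intersection -1, a vertex would be the sum of the vertices
    adjacent to it, and these are some of its neighbours. *)
Lemma no_minus_one_curve v n : vertices (E7 R) Sigma v ->
  self_intersection (E7 R) Sigma v n -> n <> -1.
Proof.
move=> /vertices_vec[t tP ->] [_ sum_adj] n1; move: sum_adj.
rewrite n1 opprK mulr1z.
pose adj s := `[< adjacent (E7 R) Sigma (vec t) (vec s) >].
pose r := [seq s <- neighbours t | adj s].
have r_uniq : uniq [seq vec s | s <- r].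
  by rewrite (map_inj_uniq vec_inj) !filter_uniq// undup_uniq.
rewrite (@fsbigE _ _ _ _ _ [seq vec s | s <- r]) => [||w|w aw]; last 3 first.
- exact: r_uniq.
- by move=> /= /mapP[s + ->]; rewrite mem_filter => /andP[/asboolP].
- case/negP; have [s sn ws] := adjacent_neighbours tP aw; rewrite ws map_f//.
  by rewrite mem_filter sn andbT; apply/asboolP; rewrite -ws.
rewrite big_map big_seq_cond.
rewrite (eq_bigl (fun s => s \in r)) => [|s]; last first.
  rewrite andb_idr// mem_filter => /andP[/asboolP ? _]; exact/mem_set.
rewrite -big_seq.
have [u + ->] := subset_sumsP adj (neighbours t).
move=> usum /vec_inj tu; move: usum; rewrite -tu.
by apply/negP; exact: not_subset_sum.
Qed.

End Refinement.
End Minimality.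

Theorem corollary4p28 (R : realType) :
  (exists Sigma : set (set 'rV[R]_3),
     regular_refinement Sigma (groebner_fan (E7 R)) /\
     rays Sigma = profile_points (E7 R)) /\
  (forall Sigma : set (set 'rV[R]_3),
     regular_refinement Sigma (groebner_fan (E7 R)) ->
     rays Sigma = profile_points (E7 R) ->
     minimal_embedded_toric_resolution (E7 R) Sigma).
Proof.
split.
  exists (table_fan R E7_table); split; first exact: E7_table_fan_refines.
  exact: E7_table_fan_rays.
move=> Sigma refS raysS; split; first exact: resolution.
  move=> v C; rewrite raysS => vP CG; exact: irreducible_profile.
by move=> v n; apply: no_minus_one_curve => //; case: refS.
Qed.
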